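(* Let $R$ be an associative ring with identity. The following assertions are equivalent: (1) The ring $R$ is quasi-Frobenius (QF). (2) For any two left $R$-modules $M$ and $N$, $N\in\mathfrak{F}^{-1}(M)$ if and only if $M\in\underline{\mathfrak{In}}^{-1}(N)$.
   Context: Modules are unital left $R$-modules. A flat precover of a module $N$ is a morphism $g:F\to N$ with $F$ flat such that $\mathrm{Hom}(F',F)\to\mathrm{Hom}(F',N)$ is surjective for every flat module $F'$. The flat-precover completing domain $\mathfrak{F}^{-1}(M)$ is the class of all modules $N$ such that for every morphism $f:M\to N$ and every flat precover $g:F\to N$ there is a morphism $h:M\to F$ with $gh=f$. The subinjectivity domain $\underline{\mathfrak{In}}^{-1}(N)$ of a module $N$ is the class of all modules $M$ such that for every module $K$ containing $M$ as a submodule and every morphism $f:M\to N$ there is a morphism $g:K\to N$ with $g|_M=f$. *)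

(* Defs.v *)
From HB Require Import structures.
From mathcomp Require Import all_boot all_algebra.
From mathcomp Require Import generic_quotient ring_quotient boolp.
From mathcomp Require Import freeg.

Set Implicit Arguments.
Unset Strict Implicit.
Unset Printing Implicit Defensive.

Import GRing.Theory.

Local Open Scope ring_scope.
Local Open Scope quotient_scope.

(* Left R-modules are terms of [lmodType R], right R-modules are terms of     *)
(* [lmodType R^c]: for [A : lmodType R^c], [r *: a] is the element a r.       *)

Section Tensor.
Variables (R : pzRingType) (A : lmodType R^c) (M : lmodType R).

Local Notation Z_AM := {freeg (A * M)%type / int}.

Definition formal_tensor (a : A) (m : M) : Z_AM := Freeg [:: (1, (a, m))].

Inductive tensor_relations : Z_AM -> Prop :=
| TensorRelDl a a' m : tensor_relations
    (formal_tensor (a + a') m - (formal_tensor a m + formal_tensor a' m))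
| TensorRelDr a m m' : tensor_relations
    (formal_tensor a (m + m') - (formal_tensor a m + formal_tensor a m'))
| TensorRelZ (r : R) a m : tensor_relations
    (formal_tensor ((r : R^c) *: a) m - formal_tensor a (r *: m))
| TensorRel0 : tensor_relations 0
| TensorRelB x y : tensor_relations x -> tensor_relations y ->
    tensor_relations (x - y).

Definition tensor_ker : {pred Z_AM} := fun x => `[< tensor_relations x >].

Fact tensor_ker_zmod_closed : zmod_closed tensor_ker.
Proof.
split=> [|x y /asboolP xI /asboolP yI]; apply/asboolP.
  exact: TensorRel0.
exact: TensorRelB.
Qed.

HB.instance Definition _ :=
  GRing.isZmodClosed.Build Z_AM tensor_ker tensor_ker_zmod_closed.

Definition tensor : zmodType := Quotient.quot tensor_ker.

Definition tens (a : A) (m : M) : tensor :=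
  \pi_(Quotient.quot tensor_ker) (formal_tensor a m).

Lemma tensDl a a' m : tens (a + a') m = tens a m + tens a' m.
Proof.
rewrite /tens -raddfD; apply/eqP; rewrite -Quotient.idealrBE.
by apply/asboolP; apply: TensorRelDl.
Qed.

Lemma tensDr a m m' : tens a (m + m') = tens a m + tens a m'.
Proof.
rewrite /tens -raddfD; apply/eqP; rewrite -Quotient.idealrBE.
by apply/asboolP; apply: TensorRelDr.
Qed.

Lemma tensZ (r : R) a m : tens ((r : R^c) *: a) m = tens a (r *: m).
Proof.
apply/eqP; rewrite -Quotient.idealrBE.
by apply/asboolP; apply: TensorRelZ.
Qed.

(* The homomorphism induced by a balanced map [f]; for other [f] its values   *)
(* are arbitrary. [zmodule T] is [T] as a module over [int].                *)
Definition tensor_lift (T : zmodType) (f : A -> M -> T) (x : tensor) : T :=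
  fglift (fun am => f am.1 am.2 : zmodule T) (repr x).

Definition balanced (T : zmodType) (f : A -> M -> T) : Prop :=
  [/\ forall a a' m, f (a + a') m = f a m + f a' m,
      forall a m m', f a (m + m') = f a m + f a m' &
      forall (r : R) a m, f ((r : R^c) *: a) m = f a (r *: m)].

Section Lift.
Variables (T : zmodType) (f : A -> M -> T).
Hypothesis f_bal : balanced f.

Let F : Z_AM -> T := fglift (fun am => f am.1 am.2 : zmodule T).

Let FB : zmod_morphism F.
Proof.
exact: (@lift_is_additive _ _ (zmodule T) (fun am => f am.1 am.2)).
Qed.

Let F1 a m : F (formal_tensor a m) = f a m.
Proof. by rewrite /F liftU scale1r. Qed.

Let F0 : F 0 = 0.
Proof. by have := FB 0 0; rewrite !subrr. Qed.

Let FD x y : F (x + y) = F x + F y.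
Proof. by rewrite -{1}[y]opprK -[- y]sub0r !FB F0 sub0r opprK. Qed.

Let F_ker x : x \in tensor_ker -> F x = 0.
Proof.
case: f_bal => fDl fDr fZ /asboolP; elim=> {x}.
- by move=> a a' m; rewrite FB FD !F1 fDl subrr.
- by move=> a m m'; rewrite FB FD !F1 fDr subrr.
- by move=> r a m; rewrite FB !F1 fZ subrr.
- exact: F0.
by move=> x y _ Fx _ Fy; rewrite FB Fx Fy subrr.
Qed.

Let tensor_lift_pi x :
  tensor_lift f (\pi_(Quotient.quot tensor_ker) x) = F x.
Proof.
rewrite /tensor_lift -/F; apply/eqP; rewrite -subr_eq0 -FB; apply/eqP/F_ker.
by rewrite Quotient.idealrBE reprK.
Qed.

Lemma tensor_lift_tens a m : tensor_lift f (tens a m) = f a m.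
Proof. by rewrite tensor_lift_pi F1. Qed.

Lemma tensor_lift_zmod_morphism : zmod_morphism (tensor_lift f).
Proof.
move=> x y; rewrite -[x]reprK -[y]reprK.
by rewrite -raddfB !tensor_lift_pi FB.
Qed.

End Lift.
End Tensor.

Definition tensor_map (R : pzRingType) (A B : lmodType R^c) (i : A -> B)
    (M : lmodType R) : tensor A M -> tensor B M :=
  tensor_lift (fun a m => tens (i a) m).

Lemma tensor_map_balanced (R : pzRingType) (A B : lmodType R^c)
    (i : {linear A -> B}) (M : lmodType R) :
  balanced (fun (a : A) (m : M) => tens (i a) m).
Proof.
split=> [a a' m|a m m'|r a m]; first by rewrite linearD tensDl.
  by rewrite tensDr.
by rewrite linearZ tensZ.
Qed.

Definition flat (R : pzRingType) (M : lmodType R) : Prop :=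
  forall (A B : lmodType R^c) (i : {linear A -> B}),
    injective i -> injective (@tensor_map R A B i M).

Definition flat_precover (R : pzRingType) (N F : lmodType R)
    (g : {linear F -> N}) : Prop :=
  flat F /\
  forall F' : lmodType R, flat F' ->
    forall u : {linear F' -> N}, exists v : {linear F' -> F}, g \o v =1 u.

(* [flat_precover_completing_domain M N] reads: N is in F^{-1}(M). *)
Definition flat_precover_completing_domain (R : pzRingType)
    (M N : lmodType R) : Prop :=
  forall (f : {linear M -> N}) (F : lmodType R) (g : {linear F -> N}),
    flat_precover g -> exists h : {linear M -> F}, g \o h =1 f.

(* [subinjectivity_domain N M] reads: M is in In^{-1}(N). A module containing *)
(* M as a submodule is given with the inclusion [i].                          *)
Definition subinjectivity_domain (R : pzRingType) (N M : lmodType R) : Prop :=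
  forall (K : lmodType R) (i : {linear M -> K}), injective i ->
    forall f : {linear M -> N}, exists g : {linear K -> N}, g \o i =1 f.

Definition injective_module (R : pzRingType) (E : lmodType R) : Prop :=
  forall (A B : lmodType R) (i : {linear A -> B}), injective i ->
    forall f : {linear A -> E}, exists g : {linear B -> E}, g \o i =1 f.

Definition left_ideal (R : pzRingType) (I : R -> Prop) : Prop :=
  [/\ I 0, forall x y, I x -> I y -> I (x + y) & forall r x, I x -> I (r * x)].

Definition left_noetherian (R : pzRingType) : Prop :=
  forall I : nat -> R -> Prop,
    (forall n, left_ideal (I n)) ->
    (forall n x, I n x -> I n.+1 x) ->
    exists n, forall m x, (n <= m)%N -> I m x -> I n x.

(* One-sided textbook definition; the notion is left-right symmetric. *)
Definition quasi_Frobenius (R : pzRingType) : Prop :=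
  left_noetherian R /\ injective_module (R^o : lmodType R).

(* Main.v *)
From HB Require Import structures.
Require Import Defs.
From mathcomp Require Import all_boot all_algebra.
From mathcomp Require Import generic_quotient ring_quotient.
From mathcomp Require Import boolp classical_sets functions.
From mathcomp Require Import freeg.

Set Implicit Arguments.
Unset Strict Implicit.
Unset Printing Implicit Defensive.

Import GRing.Theory Num.Theory.

Local Open Scope ring_scope.

(** Flatness is used through the equational criterion: a module [F] is flat iff
every finite system of relations [a x = 0] in [F] is explained by [x = c y] with
[a c = 0].

Suppose that all flat left modules are injective. The kernel of a surjection
[P -> F] between flat modules is pure in [P], hence flat, hence injective, so the
surjection splits; in particular the free cover [R^(N) -> N] is a flat precover.

If [R] is quasi-Frobenius, left ideals are finitely presented and a map from a left
ideal to a flat module factors through a finite free, hence injective, module; by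
Baer's criterion flat modules are injective. So a map [M -> N] that factors through
[R^(N)] extends to every overmodule of [M]. Conversely, [R] is left artinian and every
simple module embeds in [R], so [M] embeds in a power of [R], and powers of [R] are
flat because the solutions of a finite linear system form a finitely generated right
module. Hence a map [M -> N] that extends to this power factors through every flat
precover of [N].

If (2) holds, a flat [M] has every [N] in its completing domain, so it splits off
every overmodule and is injective; an injective [E] has itself in its completing
domain, so it is a direct summand of [R^(E)] and is flat. Thus [E^(nat)] is injective
for every injective [E], and [R] is left noetherian by the Bass-Papp argument. *)

(** * Submodules and quotient modules *)

Definition linear_fun (R : pzRingType) (U V : lmodType R) (f : U -> V)
    (f_lin : linear f) : {linear U -> V} :=
  HB.pack f (GRing.isLinear.Build R U V *:%R f f_lin).

Definition additive_fun (U V : zmodType) (f : U -> V) (fB : zmod_morphism f) :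
    {additive U -> V} :=
  HB.pack f (GRing.isZmodMorphism.Build U V f fB).

Fact scale_map_linear (R : pzRingType) (V : lmodType R) (v : V) :
  linear (fun r : R^o => (r : R) *: v).
Proof. by move=> r x y; rewrite scalerDl scalerA. Qed.

Definition scale_map (R : pzRingType) (V : lmodType R) (v : V) : {linear R^o -> V} :=
  linear_fun (scale_map_linear v).

Definition is_submodule (R : pzRingType) (V : lmodType R) (S : V -> Prop) :=
  [/\ S 0, forall x y, S x -> S y -> S (x + y) & forall r x, S x -> S (r *: x)].

Section SubmoduleTheory.
Variables (R : pzRingType) (V : lmodType R) (S : V -> Prop).
Hypothesis S_sub : is_submodule S.

Lemma submodule0 : S 0.
Proof. by case: S_sub. Qed.

Lemma submoduleD x y : S x -> S y -> S (x + y).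
Proof. by case: S_sub => _ + _; apply. Qed.

Lemma submoduleZ r x : S x -> S (r *: x).
Proof. by case: S_sub => _ _; apply. Qed.

Lemma submoduleN x : S x -> S (- x).
Proof. by rewrite -scaleN1r; apply: submoduleZ. Qed.

Lemma submoduleB x y : S x -> S y -> S (x - y).
Proof. by move=> Sx Sy; apply: submoduleD => //; apply: submoduleN. Qed.

Lemma submodule_sum (I : Type) (r : seq I) (P : pred I) (F : I -> V) :
  (forall i, P i -> S (F i)) -> S (\sum_(i <- r | P i) F i).
Proof. by move=> SF; apply: big_ind => //; [exact: submodule0 | exact: submoduleD]. Qed.

End SubmoduleTheory.

Lemma zmod_submodule (V : zmodType) (S : V -> Prop) :
    S 0 -> (forall x y, S x -> S y -> S (x - y)) ->
  is_submodule (S : zmodule V -> Prop).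
Proof.
move=> S0 SB.
have SN x : S x -> S (- x) by rewrite -sub0r; apply: SB.
have SD x y : S x -> S y -> S (x + y) by rewrite -{2}[y]opprK => Sx /SN; apply: SB.
have Sn n x : S x -> S (x *+ n).
  by move=> Sx; elim: n => [//|n IHn]; rewrite mulrS; apply: SD.
by split=> // -[] n x Sx; [apply: Sn | apply/SN/Sn].
Qed.

Section SubmoduleConstructions.
Variable R : pzRingType.
Implicit Types U V W : lmodType R.

Lemma zero_submodule V : is_submodule (fun x : V => x = 0).
Proof.
split=> // [x y -> ->|r x ->]; first exact: addr0.
exact: scaler0.
Qed.

Lemma preim_submodule V W (f : {linear V -> W}) (S : W -> Prop) :
  is_submodule S -> is_submodule (fun x => S (f x)).
Proof.
move=> S_sub; split=> [|x y Sx Sy|r x Sx].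
- by rewrite linear0; apply: submodule0.
- by rewrite linearD; apply: submoduleD.
by rewrite linearZ_LR; apply: submoduleZ.
Qed.

Lemma ker_submodule V W (f : {linear V -> W}) : is_submodule (fun x => f x = 0).
Proof. exact: (preim_submodule f (zero_submodule W)). Qed.

Lemma image_submodule V W (f : {linear V -> W}) (S : V -> Prop) :
  is_submodule S -> is_submodule (fun y => exists2 x, S x & f x = y).
Proof.
move=> S_sub; split=> [|_ _ [x Sx <-] [x' Sx' <-]|r _ [x Sx <-]].
- by exists 0; [exact: submodule0 | exact: linear0].
- by exists (x + x'); [exact: submoduleD | exact: linearD].
by exists (r *: x); [exact: submoduleZ | exact: linearZ_LR].
Qed.

Lemma range_submodule V W (f : {linear V -> W}) :
  is_submodule (fun y => exists x, f x = y).
Proof.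
split=> [|_ _ [x <-] [x' <-]|r _ [x <-]]; first by exists 0; apply: linear0.
  by exists (x + x'); apply: linearD.
by exists (r *: x); apply: linearZ_LR.
Qed.

Lemma bigcap_submodule V (X : Type) (S : X -> V -> Prop) :
  (forall x, is_submodule (S x)) -> is_submodule (fun v => forall x, S x v).
Proof.
move=> S_sub; split=> [x|u v Su Sv x|r v Sv x].
- exact: (submodule0 (S_sub x)).
- exact: (submoduleD (S_sub x)).
exact: (submoduleZ (S_sub x)).
Qed.

Lemma meet_submodule V (S T : V -> Prop) :
  is_submodule S -> is_submodule T -> is_submodule (fun v => S v /\ T v).
Proof.
move=> S_sub T_sub; split=> [|x y [Sx Tx] [Sy Ty]|r x [Sx Tx]].
- by split; apply: submodule0.
- by split; apply: submoduleD.
by split; apply: submoduleZ.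
Qed.

Lemma directed_submodule V (X : Type) (S : X -> V -> Prop) (x0 : X) :
    (forall x, is_submodule (S x)) ->
    (forall x y, exists z, (forall v, S x v -> S z v) /\ (forall v, S y v -> S z v)) ->
  is_submodule (fun v => exists x, S x v).
Proof.
move=> S_sub S_dir; split=> [|u v [x Su] [y Sv]|r v [x Sv]].
- by exists x0; apply: submodule0.
- by have [z [xz yz]] := S_dir x y; exists z; apply: submoduleD; [|apply: xz|apply: yz].
by exists x; apply: submoduleZ.
Qed.

Definition adjoin V (S : V -> Prop) (z : V) : V -> Prop :=
  fun x => exists y r, S y /\ x = y + r *: z.

Lemma adjoin_submodule V (S : V -> Prop) z :
  is_submodule S -> is_submodule (adjoin S z).
Proof.
move=> S_sub; split.
- by exists 0, 0; rewrite scale0r addr0; split=> //; apply: submodule0.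
- move=> _ _ [y [r [Sy ->]]] [y' [r' [Sy' ->]]]; exists (y + y'), (r + r').
  by rewrite scalerDl addrACA; split=> //; apply: submoduleD.
move=> t _ [y [r [Sy ->]]]; exists (t *: y), (t * r).
by rewrite scalerDr scalerA; split=> //; apply: submoduleZ.
Qed.

Lemma sub_adjoin V (S : V -> Prop) z x : S x -> adjoin S z x.
Proof. by move=> Sx; exists x, 0; rewrite scale0r addr0. Qed.

Lemma mem_adjoin V (S : V -> Prop) z : is_submodule S -> adjoin S z z.
Proof.
by move=> S_sub; exists 0, 1; rewrite scale1r add0r; split=> //; apply: submodule0.
Qed.

End SubmoduleConstructions.

Section Submod.
Variables (R : pzRingType) (V : lmodType R) (S : V -> Prop).
Variable S_sub : is_submodule S.

Definition submod_pred of is_submodule S : {pred V} := fun x => `[< S x >].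

Fact submod_pred_closed : submod_closed (submod_pred S_sub).
Proof.
split=> [|r x y /asboolP Sx /asboolP Sy]; apply/asboolP.
  exact: submodule0 S_sub.
by apply: submoduleD => //; apply: submoduleZ.
Qed.
HB.instance Definition _ :=
  GRing.isSubmodClosed.Build R V (submod_pred S_sub) submod_pred_closed.

Record submod := Submod {
  submod_val :> V; submod_valP : submod_val \in submod_pred S_sub }.
HB.instance Definition _ := [isSub for submod_val].
HB.instance Definition _ := [Choice of submod by <:].
HB.instance Definition _ := [SubChoice_isSubLmodule of submod by <:].

Definition submod_in (x : V) (Sx : S x) : submod :=
  @Submod x (introT (asboolP _) Sx).

Lemma submodP (x : submod) : S (submod_val x).
Proof. exact/asboolP/submod_valP. Qed.

Definition submod_incl : {linear submod -> V} :=
  linear_fun (fun r x y => erefl : submod_val (r *: x + y) = _).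

Lemma submod_incl_inj : injective submod_incl.
Proof. exact: val_inj. Qed.

Section Corestriction.
Variables (U : lmodType R) (f : {linear U -> V}) (Sf : forall x, S (f x)).

Fact submod_corestr_linear : linear (fun x => submod_in (Sf x)).
Proof. by move=> r x y; apply: val_inj; rewrite /= linearP. Qed.

Definition submod_corestr : {linear U -> submod} := linear_fun submod_corestr_linear.

End Corestriction.

Definition quotmod : Type := Quotient.quot (submod_pred S_sub).
HB.instance Definition _ := GRing.Zmodule.on quotmod.

Definition quotmod_class (x : V) : quotmod :=
  \pi_(Quotient.quot (submod_pred S_sub))%qT x.

Fact quotmod_classD : {morph quotmod_class : x y / x + y}.
Proof. exact: (raddfD \pi_(Quotient.quot (submod_pred S_sub))%qT). Qed.

Lemma quotmod_class_eq x y : quotmod_class x = quotmod_class y <-> S (x - y).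
Proof.
rewrite /quotmod_class; split=> [/eqP|Sxy].
  by rewrite -Quotient.idealrBE => /asboolP.
by apply/eqP; rewrite -Quotient.idealrBE; apply/asboolP.
Qed.

Fact quotmod_classP (z : quotmod) : exists x, quotmod_class x = z.
Proof. by exists (repr z); apply: reprK. Qed.

Definition quotmod_scale (r : R) (z : quotmod) : quotmod := quotmod_class (r *: repr z).

Fact quotmod_scale_class r x :
  quotmod_scale r (quotmod_class x) = quotmod_class (r *: x).
Proof.
apply/quotmod_class_eq; rewrite -scalerBr; apply: (submoduleZ S_sub).
by apply/quotmod_class_eq; apply: reprK.
Qed.

Fact quotmod_scaleA a b z :
  quotmod_scale a (quotmod_scale b z) = quotmod_scale (a * b) z.
Proof. by have [x <-] := quotmod_classP z; rewrite !quotmod_scale_class scalerA. Qed.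
Fact quotmod_scale1 : left_id 1 quotmod_scale.
Proof.
by move=> z; have [x <-] := quotmod_classP z; rewrite quotmod_scale_class scale1r.
Qed.
Fact quotmod_scaleDr : right_distributive quotmod_scale +%R.
Proof.
move=> r z z'; have [x <-] := quotmod_classP z; have [x' <-] := quotmod_classP z'.
by rewrite -quotmod_classD !quotmod_scale_class scalerDr quotmod_classD.
Qed.
Fact quotmod_scaleDl z : {morph quotmod_scale^~ z : a b / a + b}.
Proof.
move=> a b; have [x <-] := quotmod_classP z.
by rewrite !quotmod_scale_class scalerDl quotmod_classD.
Qed.
HB.instance Definition _ := GRing.Zmodule_isLmodule.Build R quotmod
  quotmod_scaleA quotmod_scale1 quotmod_scaleDr quotmod_scaleDl.

Fact quotmod_class_linear : linear quotmod_class.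
Proof. by move=> r x y; rewrite quotmod_classD -quotmod_scale_class. Qed.

Definition quotmod_pi : {linear V -> quotmod} := linear_fun quotmod_class_linear.

Lemma quotmod_pi_surj z : exists x, quotmod_pi x = z.
Proof. exact: quotmod_classP. Qed.

Lemma quotmod_pi_eq0 x : quotmod_pi x = 0 <-> S x.
Proof.
by rewrite -[0](linear0 quotmod_pi) -{2}[x]subr0; apply: quotmod_class_eq.
Qed.

End Submod.

Section Factorization.
Variable R : pzRingType.
Implicit Types A B E F P U V : lmodType R.

Lemma factor_surjective P F V (p : {linear P -> F}) (f : {linear P -> V}) :
    (forall z, exists x, p x = z) -> (forall x, p x = 0 -> f x = 0) ->
  exists g : {linear F -> V}, forall x, g (p x) = f x.
Proof.
move=> p_surj ker_sub; have [s sK] := choice p_surj.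
have sP x : f (s (p x)) = f x.
  by apply/eqP; rewrite -subr_eq0 -linearB ker_sub // linearB sK subrr.
have fs_lin : linear (f \o s).
  by move=> r z z'; rewrite -[z]sK -[z']sK -linearP /= !sP linearP.
by exists (linear_fun fs_lin).
Qed.

Lemma image_factorization U V (f : {linear U -> V}) :
  exists (W : lmodType R) (p : {linear U -> W}) (i : {linear W -> V}),
    [/\ forall z, exists x, p x = z, injective i & forall x, i (p x) = f x].
Proof.
exists (submod (range_submodule f)).
exists (submod_corestr (range_submodule f) (fun x => ex_intro _ x erefl)).
exists (submod_incl (range_submodule f)); split=> // [z|]; last exact: submod_incl_inj.
by have [x fx] := submodP z; exists x; apply: val_inj.
Qed.

Lemma factor_injective E A B (u : {linear A -> B}) (f : {linear A -> E}) :
    injective_module E -> (forall x, u x = 0 -> f x = 0) ->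
  exists g : {linear B -> E}, forall x, g (u x) = f x.
Proof.
move=> E_inj ker_sub; have [W [p [i [p_surj i_inj ip]]]] := image_factorization u.
have [|h hE] := factor_surjective (f := f) p_surj.
  by move=> x px0; apply: ker_sub; rewrite -ip px0 linear0.
by have [g gE] := E_inj _ _ i i_inj h; exists g => x; rewrite -ip -hE -gE.
Qed.

End Factorization.

(** * Finitely supported functions and free modules *)

Section FinSupp.
Variables (R : pzRingType) (X : choiceType) (V : lmodType R).

Definition finsupp_fun (f : X -> V) :=
  exists s : seq X, forall x, x \notin s -> f x = 0.

Lemma finsupp_submodule : is_submodule finsupp_fun.
Proof.
split=> [|f g [s fs] [t gt]|r f [s fs]]; first by exists [::].
  exists (s ++ t) => x; rewrite mem_cat negb_or => /andP[xs xt].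
  by rewrite -[RHS]addr0 -{1}(fs x) // -(gt x).
by exists s => x xs; rewrite -(scaler0 _ r) -(fs x).
Qed.

Definition finsupp : lmodType R := submod finsupp_submodule.

Definition fseval (f : finsupp) : X -> V := submod_val f.

Lemma finsuppP (f g : finsupp) : fseval f =1 fseval g -> f = g.
Proof. by move=> /funext fg; apply: val_inj. Qed.

Lemma fsevalD f g x : fseval (f + g) x = fseval f x + fseval g x.
Proof. by []. Qed.

Lemma fsevalB f g x : fseval (f - g) x = fseval f x - fseval g x.
Proof. by []. Qed.

Lemma fsevalZ r f x : fseval (r *: f) x = r *: fseval f x.
Proof. by []. Qed.

Lemma fseval_sum (I : Type) (r : seq I) (P : pred I) (F : I -> finsupp) x :
  fseval (\sum_(i <- r | P i) F i) x = \sum_(i <- r | P i) fseval (F i) x.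
Proof. by elim/big_rec2: _ => // i y f _ <-; rewrite fsevalD. Qed.

Definition covers (s : seq X) (f : finsupp) := forall x, x \notin s -> fseval f x = 0.

Lemma covers_exists (I : finType) (f : I -> finsupp) :
  exists2 s, uniq s & forall i, covers s (f i).
Proof.
have [t tP] := choice (fun i => submodP (f i)).
exists (undup (flatten [seq t i | i : I])); first exact: undup_uniq.
move=> i x; rewrite mem_undup => xt; apply: (tP i); apply: contra xt => xti.
by apply/flatten_imageP; exists i.
Qed.

Lemma covers_subset (s t : seq X) f : {subset s <= t} -> covers s f -> covers t f.
Proof. by move=> st fs x xt; apply: fs; apply: contra xt => /st. Qed.

Fact fsingle_finsupp x (v : V) : finsupp_fun (fun y => if y == x then v else 0).
Proof. by exists [:: x] => y; rewrite inE => /negPf ->. Qed.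

Fact fsingle_linear x :
  linear (fun v => submod_in finsupp_submodule (fsingle_finsupp x v)).
Proof.
move=> r u v; apply: finsuppP => y; rewrite fsevalD fsevalZ /fseval /=.
by case: eqP => // _; rewrite scaler0 addr0.
Qed.

Definition fsingle x : {linear V -> finsupp} := linear_fun (fsingle_linear x).

Lemma fsingleE x v y : fseval (fsingle x v) y = if y == x then v else 0.
Proof. by []. Qed.

Lemma finsupp_sum_fsingle (f : finsupp) (s : seq X) : uniq s -> covers s f ->
  f = \sum_(x <- s) fsingle x (fseval f x).
Proof.
move=> s_uniq fs; apply: finsuppP => y; rewrite fseval_sum.
have [ys|ys] := boolP (y \in s); last first.
  rewrite fs // big_seq big1 // => x xs; rewrite fsingleE ifN //.
  by apply: contraNneq ys => ->.
rewrite (bigD1_seq y) // fsingleE eqxx big1 => [|x]; first by rewrite /= addr0.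
by rewrite eq_sym fsingleE => /negPf ->.
Qed.

End FinSupp.
Arguments fsingle {R X V} x.

Section FinSuppLift.
Variables (R : pzRingType) (X : choiceType) (V : lmodType R) (W : zmodType).
Variable phi : X -> {additive V -> W}.
Implicit Types f g : finsupp X V.

Definition finsupp_lift_fun f : W :=
  \sum_(x <- s2val (cid2 (covers_exists (fun _ : unit => f)))) phi x (fseval f x).

Fact finsupp_lift_fun_cover f s : uniq s -> covers s f ->
  finsupp_lift_fun f = \sum_(x <- s) phi x (fseval f x).
Proof.
rewrite /finsupp_lift_fun; case: cid2 => t /= t_uniq /(_ tt) ft s_uniq fs.
pose G x := phi x (fseval f x).
have nonzero (w : seq X) :
    \sum_(x <- w) G x = \sum_(x <- [seq y <- w | fseval f y != 0]) G x.
  rewrite big_filter [LHS](bigID (fun x => fseval f x != 0)) /=.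
  by rewrite [X in _ + X]big1 ?addr0 // => x /negPn/eqP fx0; rewrite /G fx0 raddf0.
rewrite -!/(G _) (nonzero t) (nonzero s).
apply: perm_big; apply: uniq_perm; rewrite ?filter_uniq // => x.
rewrite !mem_filter; case: (altP (fseval f x =P 0)) => //= fx0.
have -> : x \in s by apply: contraNT fx0 => xs; rewrite fs.
by apply: contraNT fx0 => xt; rewrite ft.
Qed.

Fact finsupp_lift_fun_zmod_morphism : zmod_morphism finsupp_lift_fun.
Proof.
move=> f g; have [s s_uniq fgs] := covers_exists (fun b : bool => if b then f else g).
have fs : covers s f := fgs true; have gs : covers s g := fgs false.
rewrite !(@finsupp_lift_fun_cover _ s) // => [|x xs]; last first.
  by rewrite fsevalB fs // gs // subr0.
by rewrite -sumrB; apply: eq_bigr => x _; rewrite fsevalB raddfB.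
Qed.

Definition finsupp_lift : {additive finsupp X V -> W} :=
  additive_fun finsupp_lift_fun_zmod_morphism.

Lemma finsupp_lift_cover f s : uniq s -> covers s f ->
  finsupp_lift f = \sum_(x <- s) phi x (fseval f x).
Proof. exact: finsupp_lift_fun_cover. Qed.

Lemma finsupp_lift_fsingle x v : finsupp_lift (fsingle x v) = phi x v.
Proof.
rewrite (@finsupp_lift_cover _ [:: x]) // => [|y].
  by rewrite big_seq1 fsingleE eqxx.
by rewrite inE fsingleE => /negPf ->.
Qed.

End FinSuppLift.

Section FreeModule.
Variables (R : pzRingType) (X : choiceType).

Definition free_module : lmodType R := finsupp X (R^o : lmodType R).
Definition free_gen (x : X) : free_module := fsingle x (1 : R^o).

Variables (V : lmodType R) (phi : X -> V).

Let scale_phi x : {linear R^o -> V} := scale_map (phi x).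

Fact free_lift_linear : linear (fun f : free_module => finsupp_lift scale_phi f).
Proof.
move=> r f g; rewrite raddfD; congr (_ + _).
have [s s_uniq /(_ tt) fs] := covers_exists (fun _ : unit => f).
rewrite !(finsupp_lift_cover _ s_uniq) // => [|x xs]; last first.
  by rewrite fsevalZ fs // scaler0.
by rewrite scaler_sumr; apply: eq_bigr => x _; apply: (linearZ_LR (scale_phi x)).
Qed.

Definition free_lift : {linear free_module -> V} := linear_fun free_lift_linear.

Lemma free_lift_cover (f : free_module) s : uniq s -> covers s f ->
  free_lift f = \sum_(x <- s) (fseval f x : R) *: phi x.
Proof. exact: (finsupp_lift_cover scale_phi). Qed.

Lemma free_lift_gen x : free_lift (free_gen x) = phi x.
Proof. by rewrite [LHS](finsupp_lift_fsingle scale_phi); apply: scale1r. Qed.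

End FreeModule.

Lemma free_lift_id_surj (R : pzRingType) (V : lmodType R) (v : V) :
  exists f, free_lift id f = v.
Proof. by exists (free_gen R v); rewrite free_lift_gen. Qed.

Lemma linear_free_lift (R : pzRingType) (X : choiceType) (V W : lmodType R)
    (u : {linear V -> W}) (phi : X -> V) f :
  u (free_lift phi f) = free_lift (u \o phi) f.
Proof.
have [s s_uniq /(_ tt) fs] := covers_exists (fun _ : unit => f).
rewrite !(free_lift_cover _ s_uniq) // linear_sum.
by apply: eq_bigr => x _; rewrite linearZ.
Qed.

Section FiniteFree.
Variables (R : pzRingType) (V : lmodType R) (I : finType).

Definition basis_vec (i : I) : {ffun I -> R^o} := [ffun j => (j == i)%:R].

Lemma sum_basis_vec (t : {ffun I -> R^o}) : t = \sum_i t i *: basis_vec i.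
Proof.
apply/ffunP => j; rewrite sum_ffunE (bigD1 j) //= !ffunE eqxx.
rewrite big1 ?addr0 => [|i /negPf ij]; last by rewrite !ffunE eq_sym ij scaler0.
by rewrite [RHS]mulr1.
Qed.

Variable x : I -> V.

Fact lincomb_linear : linear (fun t : {ffun I -> R^o} => \sum_i (t i : R) *: x i).
Proof.
move=> r t t'; rewrite scaler_sumr -big_split /=; apply: eq_bigr => i _.
by rewrite !ffunE scalerDl scalerA.
Qed.

Definition lincomb : {linear {ffun I -> R^o} -> V} := linear_fun lincomb_linear.

Lemma lincombE t : lincomb t = \sum_i (t i : R) *: x i.
Proof. by []. Qed.

Lemma lincomb_basis_vec i : lincomb (basis_vec i) = x i.
Proof.
rewrite lincombE (bigD1 i) //= ffunE eqxx scale1r big1 ?addr0 // => j /negPf ji.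
by rewrite ffunE ji scale0r.
Qed.

End FiniteFree.

Lemma linear_lincomb (R : pzRingType) (V W : lmodType R) (I : finType)
    (u : {linear V -> W}) (x : I -> V) t :
  u (lincomb x t) = lincomb (u \o x) t.
Proof. by rewrite !lincombE linear_sum; apply: eq_bigr => i _; rewrite linearZ. Qed.

(** * The equational criterion for flatness *)

Definition trivial_relations (R : pzRingType) (F : lmodType R) (I J : finType)
    (a : J -> I -> R) (x : I -> F) : Prop :=
  exists (K : finType) (y : K -> F) (c : I -> K -> R),
    (forall i, x i = \sum_k c i k *: y k) /\
    (forall j k, \sum_i a j i * c i k = 0).

Definition eq_flat (R : pzRingType) (F : lmodType R) : Prop :=
  forall (I J : finType) (a : J -> I -> R) (x : I -> F),
    (forall j, \sum_i a j i *: x i = 0) -> trivial_relations a x.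

Section TrivialRelations.
Variables (R : pzRingType) (I J : finType) (a : J -> I -> R).
Implicit Types F G : lmodType R.

Lemma trivial_relations_scale F (r : I -> R) (y : F) :
  (forall j, \sum_i a j i * r i = 0) -> trivial_relations a (fun i => r i *: y).
Proof.
move=> ar0; exists unit, (fun=> y), (fun i _ => r i); split=> // i.
by rewrite (big_pred1 tt) // => -[].
Qed.

Lemma trivial_relations_linear F G (f : {linear F -> G}) (x : I -> F) :
  trivial_relations a x -> trivial_relations a (f \o x).
Proof.
move=> [K [y [c [xE ac0]]]]; exists K, (f \o y), c; split=> // i.
by rewrite /= xE linear_sum; apply: eq_bigr => k _; rewrite linearZ.
Qed.

Lemma trivial_relationsB F (x y : I -> F) : trivial_relations a x ->
  trivial_relations a y -> trivial_relations a (fun i => x i - y i).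
Proof.
move=> [K [v [c [xE ac0]]]] [L [w [d [yE ad0]]]].
exists (K + L)%type, (fun k => match k with inl k => v k | inr l => - w l end),
  (fun i k => match k with inl k => c i k | inr l => d i l end); split=> [i|j []//].
rewrite big_sumType xE yE -sumrN; congr (_ + _).
by apply: eq_bigr => l _; rewrite scalerN.
Qed.

Lemma trivial_relations_submodule F :
  is_submodule (fun x : zmodule {ffun I -> F} => trivial_relations a x).
Proof.
apply: zmod_submodule => [|x y ax ay].
  by exists 'I_0, (fun=> 0), (fun _ _ => 0); split=> [i|j []//]; rewrite ffunE big_ord0.
have [K [z [c [xyE ac0]]]] := trivial_relationsB ax ay.
by exists K, z, c; split=> // i; rewrite -xyE !ffunE.
Qed.

End TrivialRelations.

Section EqFlat.
Variable R : pzRingType.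
Implicit Types F P V : lmodType R.

Lemma eq_flat_retract F P (s : {linear F -> P}) (p : {linear P -> F}) :
  (forall x, p (s x) = x) -> eq_flat P -> eq_flat F.
Proof.
move=> sK P_flat I J a x ax0; suff: trivial_relations a (p \o (s \o x)).
  by rewrite (_ : p \o _ = x) //; apply/funext => i /=.
apply/trivial_relations_linear/P_flat => j.
rewrite -[RHS](linear0 s) -(ax0 j) linear_sum.
by apply: eq_bigr => i _; rewrite linearZ.
Qed.

Lemma eq_flat_regular : eq_flat (R^o : lmodType R).
Proof.
move=> I J a x ax0; suff: trivial_relations a (fun i => (x i : R) *: (1 : R^o)).
  by rewrite (_ : (fun i => _) = x) //; apply/funext => i; apply: mulr1.
exact: trivial_relations_scale.
Qed.

Lemma eq_flat_finsupp (X : choiceType) V : eq_flat V -> eq_flat (finsupp X V).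
Proof.
move=> V_flat I J a x ax0; have [s s_uniq xs] := covers_exists x.
pose x_at u : zmodule {ffun I -> finsupp X V} := [ffun i => fsingle u (fseval (x i) u)].
have : trivial_relations a (\sum_(u <- s) x_at u : zmodule {ffun I -> finsupp X V}).
  apply: (submodule_sum (trivial_relations_submodule a (finsupp X V))) => u _.
  have -> : x_at u = fsingle u \o (fun i => fseval (x i) u) :> (I -> finsupp X V).
    by apply/funext => i; rewrite ffunE.
  apply: trivial_relations_linear; apply: V_flat => j.
  by rewrite -[RHS](congr1 (@fseval R X V ^~ u) (ax0 j)) fseval_sum.
rewrite (_ : (\sum_(u <- s) _ : {ffun I -> finsupp X V}) = x :> (I -> _)) //.
apply/funext => i; rewrite sum_ffunE [RHS](finsupp_sum_fsingle s_uniq (xs i)).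
by apply: eq_bigr => u _; rewrite ffunE.
Qed.

Lemma eq_flat_free (X : choiceType) : eq_flat (free_module R X).
Proof. exact/eq_flat_finsupp/eq_flat_regular. Qed.

(* The kernel is pure because [F] is flat: solve the relations first in [P],
   then solve the resulting ones in [F] and lift that solution back to [P]. *)
Lemma eq_flat_ker P F (p : {linear P -> F}) :
    (forall z, exists x, p x = z) -> eq_flat P -> eq_flat F ->
  eq_flat (submod (ker_submodule p)).
Proof.
move=> p_surj P_flat F_flat I J a x ax0; pose incl := submod_incl (ker_submodule p).
have [|K [y [b [xE ab0]]]] := P_flat I J a (incl \o x).
  move=> j; rewrite -[RHS](linear0 incl) -(ax0 j) linear_sum.
  by apply: eq_bigr => i _; rewrite linearZ.
have [|L [z [c [yE bc0]]]] := F_flat K I b (p \o y).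
  move=> i; rewrite -[RHS](submodP (x i)) -[submod_val _]/((incl \o x) i) xE.
  by rewrite linear_sum; apply: eq_bigr => k _; rewrite linearZ.
have [w wE] := choice (fun l => p_surj (z l)).
pose d k := y k - \sum_l c k l *: w l.
have dK k : p (d k) = 0.
  apply/eqP; rewrite linearB subr_eq0 -[p (y k)]/((p \o y) k) yE linear_sum.
  by apply/eqP/eq_bigr => l _; rewrite linearZ /= wE.
exists K, (fun k => submod_in (ker_submodule p) (dK k)), b; split=> // i.
apply: (@submod_incl_inj _ _ _ (ker_submodule p)); rewrite -[LHS]/((incl \o x) i) xE.
rewrite linear_sum -[LHS]subr0; under [RHS]eq_bigr do rewrite linearZ /= scalerBr.
rewrite sumrB; congr (_ - _); apply/esym; under eq_bigr do rewrite scaler_sumr.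
rewrite exchange_big big1 // => l _ /=; under eq_bigr do rewrite scalerA.
by rewrite -scaler_suml bc0 scale0r.
Qed.

Lemma eq_flat_surjection_splits P F (p : {linear P -> F}) :
    (forall V, eq_flat V -> injective_module V) ->
    (forall z, exists x, p x = z) -> eq_flat P -> eq_flat F ->
  exists s : {linear F -> P}, forall z, p (s z) = z.
Proof.
move=> flat_inj p_surj P_flat F_flat; pose incl := submod_incl (ker_submodule p).
have K_inj : injective_module (submod (ker_submodule p)) by apply/flat_inj/eq_flat_ker.
have [rho rhoE] := K_inj _ _ incl (@submod_incl_inj _ _ _ _) idfun.
have [|s sE] := @factor_surjective _ _ _ _ p (idfun \- (incl \o rho)) p_surj.
  move=> x px0; rewrite /= (_ : rho x = submod_in (ker_submodule p) px0) ?subrr //.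
  exact: (rhoE (submod_in (ker_submodule p) px0)).
exists s => z; have [x <-] := p_surj z.
by rewrite sE linearB [X in _ - X](submodP (rho x)) subr0.
Qed.

End EqFlat.

Section TensorCalculus.
Variables (R : pzRingType) (A : lmodType R^c) (M : lmodType R).

Fact tens_left_zmod_morphism m : zmod_morphism (fun a : A => tens a m : tensor A M).
Proof. by move=> a b; apply: (addIr (tens b m)); rewrite -tensDl !subrK. Qed.

Fact tens_right_zmod_morphism (a : A) : zmod_morphism (fun m => tens a m : tensor A M).
Proof. by move=> m n; apply: (addIr (tens a n)); rewrite -tensDr !subrK. Qed.

Definition tens_left m : {additive A -> tensor A M} :=
  additive_fun (tens_left_zmod_morphism m).

Definition tens_right a : {additive M -> tensor A M} :=
  additive_fun (tens_right_zmod_morphism a).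

Lemma tens0l m : tens (0 : A) m = 0 :> tensor A M.
Proof. exact: (raddf0 (tens_left m)). Qed.

Lemma tens0r a : tens a 0 = 0 :> tensor A M.
Proof. exact: (raddf0 (tens_right a)). Qed.

Lemma tens_suml (I : Type) (r : seq I) (P : pred I) (F : I -> A) m :
  tens (\sum_(i <- r | P i) F i) m = \sum_(i <- r | P i) tens (F i) m :> tensor A M.
Proof. exact: (raddf_sum (tens_left m)). Qed.

Lemma tens_sumr (I : Type) (r : seq I) (P : pred I) a (F : I -> M) :
  tens a (\sum_(i <- r | P i) F i) = \sum_(i <- r | P i) tens a (F i) :> tensor A M.
Proof. exact: (raddf_sum (tens_right a)). Qed.

Lemma tensor_ind (Q : tensor A M -> Prop) :
    Q 0 -> (forall x y, Q x -> Q y -> Q (x + y)) -> (forall x, Q x -> Q (- x)) ->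
    (forall a m, Q (tens a m)) ->
  forall x, Q x.
Proof.
move=> Q0 QD QN Qt x; rewrite -[x]reprK; elim/freeg_ind_dom0: (repr x).
  by rewrite raddf0.
move=> k [a m] D _ _ QD'; rewrite raddfD; apply: (QD _ _) => //.
have -> : Freeg [:: (k, (a, m))] = formal_tensor a m *~ k.
  by rewrite /formal_tensor freegU_mulz intz.
rewrite raddfMz.
have Qn n : Q (tens a m *+ n) by elim: n => [//|n IHn]; rewrite mulrS; apply: QD.
by case: k => n; rewrite ?NegzE ?mulrNz -pmulrn; [exact: Qn | apply/QN/Qn].
Qed.

Definition finsupp_tensor : {additive finsupp M A -> tensor A M} :=
  finsupp_lift tens_left.

Lemma finsupp_tensor_surj z : exists f, finsupp_tensor f = z.
Proof.
elim/tensor_ind: z => [|_ _ [f <-] [g <-]|_ [f <-]|a m].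
- by exists 0; apply: raddf0.
- by exists (f + g); apply: raddfD.
- by exists (- f); apply: raddfN.
by exists (fsingle m a); apply: finsupp_lift_fsingle.
Qed.

Lemma finsupp_tensor_cover f s : uniq s -> covers s f ->
  finsupp_tensor f = \sum_(u <- s) tens (fseval f u) u.
Proof. exact: finsupp_lift_cover. Qed.

End TensorCalculus.

Definition tensor_additive (R : pzRingType) (A : lmodType R^c) (M : lmodType R)
    (T : zmodType) (f : A -> M -> T) (f_bal : balanced f) :
    {additive tensor A M -> T} :=
  additive_fun (tensor_lift_zmod_morphism f_bal).

Section TensorMap.
Variables (R : pzRingType) (A B : lmodType R^c) (i : {linear A -> B}) (M : lmodType R).

Definition tensor_map_additive : {additive tensor A M -> tensor B M} :=
  tensor_additive (tensor_map_balanced i M).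

Lemma tensor_map_tens a m : tensor_map i (tens a m) = tens (i a) m :> tensor B M.
Proof. exact: (tensor_lift_tens (tensor_map_balanced i M)). Qed.

End TensorMap.

Section TensorRelations.
Variables (R : pzRingType) (B : lmodType R^c) (M : lmodType R).

(* [B (x) M] is the quotient of [B^(M)] by [B . K], where [K] is the kernel of
   the canonical map [R^(M) -> M]. *)
Definition tensor_trivial (f : finsupp M B) : Prop :=
  exists (J : finType) (b : J -> B) (k : J -> free_module R M),
    (forall j, free_lift id (k j) = 0) /\
    (forall u, fseval f u = \sum_j (fseval (k j) u : R^c) *: b j).

Lemma tensor_trivial_scale (k : free_module R M) (b : B) (f : finsupp M B) :
    free_lift id k = 0 -> (forall u, fseval f u = (fseval k u : R^c) *: b) ->
  tensor_trivial f.
Proof.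
move=> k0 fE; exists unit, (fun=> b), (fun=> k); split=> // u.
by rewrite (big_pred1 tt) // => -[].
Qed.

Lemma tensor_trivial_submodule :
  is_submodule (tensor_trivial : zmodule (finsupp M B) -> Prop).
Proof.
apply: zmod_submodule => [|f g [J [b [k [k0 fE]]]] [J' [b' [k' [k'0 gE]]]]].
  by exists 'I_0, (fun=> 0), (fun=> 0); split=> [[]//|u]; rewrite big_ord0.
exists (J + J')%type, (fun j => match j with inl j => b j | inr j => - b' j end),
  (fun j => match j with inl j => k j | inr j => k' j end); split=> [[]//|u].
rewrite fsevalB fE gE big_sumType -sumrN; congr (_ + _).
by apply: eq_bigr => j _; rewrite scalerN.
Qed.

Let pi := quotmod_pi tensor_trivial_submodule.

Let class (b : B) (m : M) := pi (fsingle m b).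

Lemma free_gen_scale m (b : B) u :
  (fseval (free_gen R m) u : R^c) *: b = fseval (fsingle m b : finsupp M B) u.
Proof. by rewrite !fsingleE; case: eqP; rewrite ?scale1r ?scale0r. Qed.

Lemma fsingle_class_balanced : balanced class.
Proof.
split=> [b b' m|b m m'|r b m]; rewrite /class; first by rewrite !linearD.
  rewrite -linearD; apply/quotmod_class_eq.
  apply: (tensor_trivial_scale
    (k := free_gen R (m + m') - (free_gen R m + free_gen R m')) (b := b)) => [|u].
    by rewrite linearB linearD !free_lift_gen subrr.
  by rewrite !fsevalB !fsevalD scalerBl scalerDl !free_gen_scale.
apply/quotmod_class_eq; apply: (tensor_trivial_scale
  (k := r *: free_gen R m - free_gen R (r *: m)) (b := b)) => [|u].
  by rewrite linearB linearZ !free_lift_gen subrr.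
rewrite !fsevalB scalerBl free_gen_scale linearZ !fsevalZ !fsingleE; congr (_ - _).
by case: eqP => _; rewrite ?scaler0 ?scale0r ?(mulr1 r : r *: (1 : R^o) = r).
Qed.

Lemma sum_tens_eq0 (I : Type) (r : seq I) (b : I -> B) (m : I -> M) :
    \sum_(i <- r) tens (b i) (m i) = 0 :> tensor B M ->
  tensor_trivial (\sum_(i <- r) fsingle (m i) (b i)).
Proof.
move=> sum0; apply/(quotmod_pi_eq0 tensor_trivial_submodule); rewrite -/pi.
rewrite [LHS](raddf_sum pi) -[RHS](raddf0 (tensor_additive fsingle_class_balanced)).
rewrite -sum0 raddf_sum; apply: eq_bigr => i _.
exact/esym/(tensor_lift_tens fsingle_class_balanced).
Qed.

End TensorRelations.

Section FlatCriterion.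
Variable R : pzRingType.

Lemma sum_tens_trivial_relations (A : lmodType R^c) (M : lmodType R) (I J : finType)
    (a : J -> I -> R) (x : I -> M) (alpha : I -> A) :
    trivial_relations a x ->
    (forall r : I -> R, (forall j, \sum_i a j i * r i = 0) ->
       \sum_i (r i : R^c) *: alpha i = 0) ->
  \sum_i tens (alpha i) (x i) = 0 :> tensor A M.
Proof.
move=> [K [y [c [xE ac0]]]] alpha0; under eq_bigr => i _.
  rewrite xE tens_sumr; under eq_bigr do rewrite -tensZ; over.
rewrite exchange_big big1 // => k _ /=.
by rewrite -tens_suml (alpha0 (c^~ k)) ?tens0l.
Qed.

Lemma eq_flat_flat (M : lmodType R) : eq_flat M -> flat M.
Proof.
move=> M_flat A B i i_inj; apply: (@raddf_inj _ _ (tensor_map_additive i M)) => z.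
have [f <-] := finsupp_tensor_surj z.
have [s s_uniq /(_ tt) fs] := covers_exists (fun _ : unit => f).
rewrite [in X in X -> _](finsupp_tensor_cover s_uniq fs) raddf_sum.
rewrite (eq_bigr _ (fun u _ => tensor_map_tens i (fseval f u) u)) => /sum_tens_eq0.
move=> [J [b [k [k0 ifE]]]]; have [t _ kt] := covers_exists k.
have {}ifE u : i (fseval f u) = \sum_j (fseval (k j) u : R^c) *: b j.
  rewrite -ifE fseval_sum {1}(finsupp_sum_fsingle s_uniq fs) fseval_sum linear_sum.
  by apply: eq_bigr => v _; rewrite !fsingleE; case: eqP => // _; rewrite linear0.
pose U := undup (s ++ t); have U_uniq : uniq U by apply: undup_uniq.
have fU : covers U f.
  by apply: covers_subset fs => u; rewrite mem_undup mem_cat => ->.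
have kU j : covers U (k j).
  by apply: covers_subset (kt j) => u; rewrite mem_undup mem_cat orbC => ->.
rewrite (finsupp_tensor_cover U_uniq fU) big_tnth.
pose el := tnth (in_tuple U).
apply: (sum_tens_trivial_relations (a := fun j v => fseval (k j) (el v))).
  apply: M_flat => j; rewrite -[RHS](k0 j) (free_lift_cover _ U_uniq (kU j)).
  by rewrite [RHS]big_tnth.
move=> r kr0; apply: i_inj; rewrite linear0 linear_sum.
under eq_bigr do rewrite linearZ_LR ifE scaler_sumr.
rewrite exchange_big big1 // => j _; under eq_bigr do rewrite scalerA.
by rewrite -scaler_suml [X in X *: _](kr0 j) scale0r.
Qed.

Section FlatTrivialRelations.
Variables (F : lmodType R) (I J : finType) (a : J -> I -> R).

Let L : lmodType R^c := {ffun I -> (R^c)^o}.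
Let B : lmodType R^c := {ffun J -> (R^c)^o}.

Fact columns_linear : linear (fun r : L => [ffun j => \sum_i a j i * r i : R] : B).
Proof.
move=> t r r'; apply/ffunP => j; rewrite !ffunE.
rewrite -[RHS]/((\sum_i a j i * r i) * t + \sum_i a j i * r' i) mulr_suml -big_split.
by apply: eq_bigr => i _; rewrite !ffunE /= mulrDr mulrA.
Qed.

Definition columns : {linear L -> B} := linear_fun columns_linear.

Lemma columns_basis_vec i j : columns (basis_vec R^c i) j = a j i.
Proof.
rewrite ffunE (bigD1 i) //= ffunE eqxx mulr1 big1 ?addr0 // => k /negPf ki.
by rewrite ffunE ki mulr0.
Qed.

(* Over the right module [A] generated by the columns of [a], the balanced map
   sending a combination [a r] of the columns and [y] to the class of [r y] in [F^I]
   modulo the trivially related families sends [\sum_i a_i (x) x_i] to the class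
   of [x]. *)
Let T : zmodType := quotmod (trivial_relations_submodule a F).
Let class : {linear zmodule {ffun I -> F} -> T} :=
  quotmod_pi (trivial_relations_submodule a F).

Let outer (r : L) (y : F) : {ffun I -> F} := [ffun i => (r i : R) *: y].

Variables (A : lmodType R^c) (p : {linear L -> A}) (iota : {linear A -> B}).
Hypotheses (iota_inj : injective iota) (iota_p : forall r, iota (p r) = columns r).

Lemma outer_class_eq r r' y : p r = p r' -> class (outer r y) = class (outer r' y).
Proof.
move=> /(congr1 iota); rewrite !iota_p => /eqP; rewrite -subr_eq0 -linearB => /eqP col0.
apply/quotmod_class_eq.
have -> : outer r y - outer r' y = (fun i => ((r - r') i : R) *: y) :> (I -> F).
  by apply/funext => i; rewrite !ffunE scalerBl.
by apply: trivial_relations_scale => j; have /ffunP/(_ j) := col0; rewrite !ffunE.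
Qed.

Variables (lift : A -> L) (liftK : cancel lift p).

Lemma outer_class_lift_balanced : balanced (fun b y => class (outer (lift b) y)).
Proof.
split=> [b b' y|b y y'|r b y].
- rewrite -[RHS](linearD class) (@outer_class_eq _ (lift b + lift b')); last first.
    by rewrite linearD !liftK.
  by congr (class _); apply/ffunP => i; rewrite !ffunE scalerDl.
- rewrite -[RHS](linearD class); congr (class _).
  by apply/ffunP => i; rewrite !ffunE scalerDr.
rewrite (@outer_class_eq _ ((r : R^c) *: lift b)); last by rewrite linearZ_LR !liftK.
by congr (class _); apply/ffunP => i; rewrite !ffunE scalerA.
Qed.

Variable x : I -> F.
Hypotheses (F_flat : flat F) (ax0 : forall j, \sum_i a j i *: x i = 0).

Lemma sum_tens_basis_vec_eq0 :
  \sum_i tens (p (basis_vec R^c i)) (x i) = 0 :> tensor A F.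
Proof.
apply: (F_flat iota_inj); rewrite -![tensor_map iota _]/(tensor_map_additive iota F _).
rewrite raddf0 raddf_sum.
rewrite (eq_bigr (fun i => \sum_j tens (basis_vec R^c j : B) (a j i *: x i))).
  by rewrite exchange_big big1 // => j _ /=; rewrite -tens_sumr ax0 tens0r.
move=> i _; rewrite [LHS]tensor_map_tens iota_p [columns _]sum_basis_vec tens_suml.
by apply: eq_bigr => j _; rewrite tensZ columns_basis_vec.
Qed.

Lemma relation_class_eq0 : class [ffun i => x i] = 0.
Proof.
have := congr1 (tensor_additive outer_class_lift_balanced) sum_tens_basis_vec_eq0.
rewrite raddf0 raddf_sum => <-.
have -> : [ffun i => x i] = \sum_i outer (basis_vec R^c i) (x i).
  apply/ffunP => i; rewrite sum_ffunE (bigD1 i) //= big1 => [|k /negPf ki].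
    by rewrite !ffunE eqxx scale1r addr0.
  by rewrite !ffunE eq_sym ki scale0r.
rewrite [LHS]linear_sum; apply: eq_bigr => i _.
rewrite [RHS](tensor_lift_tens outer_class_lift_balanced).
by apply: outer_class_eq; rewrite liftK.
Qed.

End FlatTrivialRelations.

Lemma flat_eq_flat (F : lmodType R) : flat F -> eq_flat F.
Proof.
move=> F_flat I J a x ax0.
have [A [p [iota [p_surj iota_inj iota_p]]]] := image_factorization (columns a).
have [lift liftK] := choice p_surj.
have := relation_class_eq0 iota_inj iota_p liftK F_flat ax0.
move=> /(quotmod_pi_eq0 (trivial_relations_submodule a F)) [K [y [c [xE ac0]]]].
by exists K, y, c; split=> // i; rewrite -xE ffunE.
Qed.

End FlatCriterion.

(** * Enough injective modules *)

Definition baer_criterion (R : pzRingType) (E : lmodType R) :=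
  forall (I : R^o -> Prop) (I_sub : is_submodule I) (f : {linear submod I_sub -> E}),
    exists y, forall r, f r = (submod_val r : R) *: y.

Lemma injective_baer (R : pzRingType) (E : lmodType R) :
  injective_module E -> baer_criterion E.
Proof.
move=> E_inj I I_sub f; have [g gE] := E_inj _ _ _ (@submod_incl_inj _ _ _ I_sub) f.
exists (g 1) => r; rewrite -gE -linearZ_LR; congr (g _).
by rewrite [RHS]mulr1.
Qed.

Section LinearGraph.
Variables (R : pzRingType) (B E : lmodType R).
Implicit Type G : B * E -> Prop.

Definition linear_graph G := is_submodule G /\ forall e, G (0, e) -> e = 0.

Lemma linear_graph_functional G b e e' :
  linear_graph G -> G (b, e) -> G (b, e') -> e = e'.
Proof.
move=> [G_sub G0] Gb Gb'; apply/eqP; rewrite -subr_eq0; apply/eqP/G0.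
by have : G (b - b, e - e') := submoduleB G_sub Gb Gb'; rewrite subrr.
Qed.

Lemma linear_graph_map G : linear_graph G -> (forall b, exists e, G (b, e)) ->
  exists g : {linear B -> E}, forall b, G (b, g b).
Proof.
move=> G_graph G_total; have [g gP] := choice G_total.
have g_lin : linear g.
  move=> r x y; apply: (linear_graph_functional G_graph (gP _)).
  exact: (submoduleD G_graph.1 (submoduleZ G_graph.1 r (gP x)) (gP y)).
by exists (linear_fun g_lin).
Qed.

Lemma linear_graph_adjoin G b : baer_criterion E -> linear_graph G ->
  exists e, linear_graph (adjoin G (b, e)).
Proof.
move=> E_baer G_graph; have [G_sub G0] := G_graph.
pose I (r : R^o) := exists e, G ((r : R) *: b, e).
have I_sub : is_submodule I.
  split=> [|r r' [e Ge] [e' Ge']|t r [e Ge]].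
  - by exists 0; rewrite scale0r; apply: submodule0 G_sub.
  - by exists (e + e'); rewrite scalerDl; apply: (submoduleD G_sub Ge Ge').
  by exists (t *: e); rewrite -scalerA; apply: (submoduleZ G_sub t Ge).
have [h hP] := choice (fun r : submod I_sub => submodP r).
have h_lin : linear h.
  move=> t r r'; apply: (linear_graph_functional G_graph (hP _)).
  rewrite -[X in G X]/((t * (submod_val r : R) + (submod_val r' : R)) *: b,
                       t *: h r + h r').
  rewrite scalerDl -scalerA.
  exact: (submoduleD G_sub (submoduleZ G_sub t (hP r)) (hP r')).
have [e eP] := E_baer I I_sub (linear_fun h_lin).
exists e; split=> [|e' [[d e''] [r [Gd [/= d0 ->]]]]]; first exact: adjoin_submodule.
have rb : r *: b = - d by apply/eqP; rewrite -addr_eq0 addrC -d0.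
have Gr : G (r *: b, - e'') by rewrite rb; apply: (submoduleN G_sub Gd).
have Ir : I r by exists (- e'').
have /= <- := eP (submod_in I_sub Ir).
by rewrite (linear_graph_functional G_graph (hP (submod_in I_sub Ir)) Gr) subrr.
Qed.

Lemma linear_graph_maximal G0 : linear_graph G0 ->
  exists G, [/\ linear_graph G, forall z, G0 z -> G z &
    forall H, linear_graph H -> (forall z, G z -> H z) -> forall z, H z -> G z].
Proof.
move=> G0_graph; pose P G := linear_graph G /\ forall z, G0 z -> G z.
pose le (G H : {G | P G}) := `[< forall z, sval G z -> sval H z >].
pose G0_P : {G | P G} := exist _ G0 (conj G0_graph (fun z => id)).
have [||C C_tot|G Gmax] := @ZL_preorder {G | P G} G0_P le.
- by move=> G; apply/asboolP.
- by move=> G H K /asboolP GH /asboolP HK; apply/asboolP => z /GH/HK.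
- have [[X0 CX0]|C0] := pselect (exists X, C X); last first.
    by exists G0_P => X CX; case: C0; exists X.
  pose U z := exists X : {X | C X}, sval (sval X) z.
  have U_graph : linear_graph U.
    split=> [|e [[X CX] /= Xe]]; last exact: (svalP X).1.2 Xe.
    apply: (directed_submodule (exist _ X0 CX0)) => [[X CX]|[X CX] [Y CY]].
      exact: (svalP X).1.1.
    by have [/asboolP XY|/asboolP YX] := C_tot X Y CX CY;
      [exists (exist _ Y CY) | exists (exist _ X CX)].
  have U_ext z : G0 z -> U z by exists (exist _ X0 CX0); apply: (svalP X0).2.
  exists (exist _ U (conj U_graph U_ext)) => X CX; apply/asboolP => z Xz.
  by exists (exist _ X CX).
exists (sval G); have [G_graph G_ext] := svalP G; split=> // H H_graph GH.
pose H' : {G | P G} := exist _ H (conj H_graph (fun z G0z => GH z (G_ext z G0z))).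
by have /asboolP := Gmax H' (introT (asboolP _) GH).
Qed.

End LinearGraph.

Lemma baer (R : pzRingType) (E : lmodType R) :
  baer_criterion E -> injective_module E.
Proof.
move=> E_baer A B i i_inj f; pose G0 z := exists a, (i a, f a) = z.
have G0_graph : linear_graph G0.
  split=> [|e [a [ia0 <-]]]; last by rewrite (i_inj a 0) ?linear0.
  split=> [|_ _ [a <-] [a' <-]|r _ [a <-]].
  - by exists 0; rewrite ?linear0.
  - by exists (a + a'); rewrite ?linearD.
  by exists (r *: a); rewrite ?linearZ_LR.
have [G [G_graph G0G Gmax]] := linear_graph_maximal G0_graph.
have [|g gP] := linear_graph_map G_graph.
  move=> b; have [e Ge_graph] := linear_graph_adjoin b E_baer G_graph.
  exists e; apply: Gmax Ge_graph _ _ _; last exact: (mem_adjoin _ G_graph.1).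
  by move=> z; apply: sub_adjoin.
by exists g => a; apply: (linear_graph_functional G_graph (gP _)); apply: G0G; exists a.
Qed.

Lemma int_ideal_principal (I : int^o -> Prop) : is_submodule I ->
  exists2 n : nat, I n%:Z & forall k, I k -> exists m : int, k = m * n%:Z.
Proof.
move=> I_sub.
have [ex_pos|no_pos] := pselect (exists n : nat, `[< I n.+1%:Z >]); last first.
  exists 0%N => [|k Ik]; first exact: submodule0 I_sub.
  exists 0; rewrite mul0r; apply: contrapT => k0; apply: no_pos.
  case: k Ik k0 => [[|n]|n] Ik k0 //; exists n; apply/asboolP => //.
  by rewrite -[Posz _]opprK -NegzE; apply: (submoduleN I_sub Ik).
case: (ex_minnP ex_pos) => n /asboolP In nmin; exists n.+1 => // k Ik.
exists (k %/ n.+1)%Z; rewrite {1}(divz_eq k n.+1).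
suff -> : (k %% n.+1)%Z = 0 by rewrite addr0.
have Imod : I (k %% n.+1)%Z.
  exact: (submoduleB I_sub Ik (submoduleZ I_sub (k %/ n.+1)%Z In)).
have : (k %% n.+1)%Z < n.+1%:Z by exact: ltz_pmod.
have : 0 <= (k %% n.+1)%Z by exact: modz_ge0.
case: (k %% n.+1)%Z Imod => // -[//|m] Im _; rewrite ltz_nat ltnS => ltmn.
by have := nmin m (introT (asboolP _) Im); rewrite leqNgt ltmn.
Qed.

Definition divisible (D : zmodType) : Prop :=
  forall (n : nat) (d : D), exists d', d' *+ n.+1 = d.

Lemma divisible_injective (D : zmodType) :
  divisible D -> injective_module (zmodule D : lmodType int).
Proof.
move=> D_div; apply: baer => I I_sub f; have [n In nP] := int_ideal_principal I_sub.
pose gen := submod_in I_sub In.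
have [y yE] : exists y : zmodule D, f gen = n%:Z *: y.
  rewrite /gen; case: n In {nP gen} => [|n] In.
    by exists 0; rewrite scaler0 -(linear0 f); congr (f _); apply: val_inj.
  by have [y yE] := D_div n (f (submod_in I_sub In)); exists y; rewrite -yE.
exists y => r; have [m rE] := nP _ (submodP r).
rewrite rE -scalerA -yE -linearZ_LR; congr (f _); apply: val_inj.
exact: rE.
Qed.

Fact additive_linear (U V : zmodType) (f : {additive U -> V}) :
  linear (f : zmodule U -> zmodule V).
Proof. by move=> k x y; rewrite [LHS](raddfD f) [X in X + _](raddfMz f). Qed.

Definition zmodule_linear (U V : zmodType) (f : {additive U -> V}) :
    {linear zmodule U -> zmodule V} :=
  linear_fun (additive_linear f).

Section DivisibleHull.
Variable V : zmodType.

Let rat_sums := finsupp V (zmodule rat : lmodType int).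
Let int_sums := free_module int V.
Let eval : {linear int_sums -> zmodule V} := free_lift (id : V -> zmodule V).

Definition integral_relation (f : rat_sums) : Prop :=
  exists2 k : int_sums, eval k = 0 & forall u, fseval f u = (fseval k u)%:~R :> rat.

Lemma integral_relation_submodule : is_submodule integral_relation.
Proof.
split=> [|f g [k k0 fE] [l l0 gE]|r f [k k0 fE]].
- by exists 0 => [|u]; rewrite ?linear0.
- by exists (k + l) => [|u]; rewrite ?linearD ?k0 ?l0 ?addr0 // fsevalD fE gE rmorphD.
exists (r *: k) => [|u]; first by rewrite linearZ_LR k0 scaler0.
by rewrite !fsevalZ fE rmorphM mulrzl.
Qed.

(* [V = Z^(V) / K] embeds in [Q^(V) / K]. *)
Definition divisible_hull : zmodType := quotmod integral_relation_submodule.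

Let pi : {linear rat_sums -> divisible_hull} := quotmod_pi integral_relation_submodule.

Lemma divisible_hull_divisible : divisible divisible_hull.
Proof.
move=> n d; have [f <-] := quotmod_pi_surj d.
have [s s_uniq /(_ tt) fs] := covers_exists (fun _ : unit => f).
exists (pi (\sum_(u <- s) fsingle u ((fseval f u : rat) / n.+1%:R : zmodule rat))).
rewrite -raddfMn {2}(finsupp_sum_fsingle s_uniq fs) -sumrMnl; congr (pi _).
apply: eq_bigr => u _; rewrite -raddfMn; congr (fsingle u _).
by rewrite -[LHS]mulr_natr divfK // pnatr_eq0.
Qed.

Fact divisible_hull_class_zmod_morphism :
  zmod_morphism
    (fun v : V => pi (fsingle v ((1 : rat) : zmodule rat)) : divisible_hull).
Proof.
move=> v w; rewrite -[RHS](linearB pi); apply/quotmod_class_eq.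
exists (free_gen int (v - w) - (free_gen int v - free_gen int w)) => [|u].
  by rewrite !(linearB eval) !free_lift_gen; apply: subrr.
rewrite !fsevalB !rmorphB; do 2?congr (_ - _); rewrite !fsingleE; by case: eqP.
Qed.

Definition divisible_hull_class : {additive V -> divisible_hull} :=
  additive_fun divisible_hull_class_zmod_morphism.

Lemma divisible_hull_class_inj : injective divisible_hull_class.
Proof.
apply: raddf_inj => v /(quotmod_pi_eq0 integral_relation_submodule) [k k0 kE].
suff kv : k = free_gen int v by rewrite -k0 kv [RHS]free_lift_gen.
apply: finsuppP => u; apply: (@intr_inj rat); rewrite -kE !fsingleE.
by case: eqP.
Qed.

End DivisibleHull.

Section Coinduced.
Variables (R : pzRingType) (D : zmodType).

Definition additive_pred : {pred R -> D} :=
  fun h => `[< {morph h : x y / x + y} >].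

Fact additive_pred_closed : zmod_closed additive_pred.
Proof.
split=> [|g h /asboolP gD /asboolP hD]; apply/asboolP => x y.
  by rewrite [RHS]addr0.
by rewrite [LHS](congr2 (fun a b => a - b) (gD x y) (hD x y)) opprD addrACA.
Qed.
HB.instance Definition _ :=
  GRing.isZmodClosed.Build (R -> D) additive_pred additive_pred_closed.

Record coinduced := Coinduced {
  coind_val :> R -> D; coind_valP : coind_val \in additive_pred }.
HB.instance Definition _ := [isSub for coind_val].
HB.instance Definition _ := [Choice of coinduced by <:].
HB.instance Definition _ := [SubChoice_isSubZmodule of coinduced by <:].

Lemma coindD (h : coinduced) : {morph h : x y / x + y}.
Proof. exact/asboolP/coind_valP. Qed.

Definition coind (h : R -> D) (hD : {morph h : x y / x + y}) : coinduced :=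
  @Coinduced h (introT (asboolP _) hD).

Lemma coindP (g h : coinduced) : g =1 h -> g = h.
Proof. by move=> /funext gh; apply: val_inj. Qed.

Fact coind_scale_add (t : R) (h : coinduced) :
  {morph (fun r => h (r * t)) : x y / x + y}.
Proof. by move=> x y; rewrite mulrDl coindD. Qed.

Definition coind_scale t h := coind (coind_scale_add t h).

Fact coind_scaleA a b h : coind_scale a (coind_scale b h) = coind_scale (a * b) h.
Proof. by apply: coindP => r /=; rewrite mulrA. Qed.
Fact coind_scale1 : left_id 1 coind_scale.
Proof. by move=> h; apply: coindP => r /=; rewrite mulr1. Qed.
Fact coind_scaleDr : right_distributive coind_scale +%R.
Proof. by move=> t g h; apply: coindP. Qed.
Fact coind_scaleDl h : {morph coind_scale^~ h : a b / a + b}.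
Proof. by move=> a b; apply: coindP => r /=; rewrite mulrDr coindD. Qed.

HB.instance Definition _ := GRing.Zmodule_isLmodule.Build R coinduced
  coind_scaleA coind_scale1 coind_scaleDr coind_scaleDl.

Section Transpose.
Variables (M : lmodType R) (g : {additive M -> D}).

Fact coind_transpose_add (m : M) : {morph (fun r : R => g (r *: m)) : r s / r + s}.
Proof. by move=> r s; rewrite scalerDl raddfD. Qed.

Fact coind_transpose_linear : linear (fun m => coind (coind_transpose_add m)).
Proof. by move=> r x y; apply: coindP => s /=; rewrite scalerDr raddfD scalerA. Qed.

Definition coind_transpose : {linear M -> coinduced} :=
  linear_fun coind_transpose_linear.

End Transpose.

(* Adjunction: linear maps to the coinduced module are additive maps to [D]. *)
Lemma coinduced_injective :
  divisible D -> injective_module (coinduced : lmodType R).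
Proof.
move=> /divisible_injective D_inj A B i i_inj f.
have f1B : zmod_morphism (fun a => f a 1) by move=> a b; rewrite linearB.
have [g gE] := D_inj _ _ (zmodule_linear i) i_inj (zmodule_linear (additive_fun f1B)).
have gB : zmod_morphism (g : B -> D) by move=> x y; apply: (linearB g).
exists (coind_transpose (additive_fun gB)) => a; apply: coindP => r /=.
rewrite -linearZ_LR; apply: etrans (gE (r *: a)) _ => /=.
by rewrite linearZ_LR /= mul1r.
Qed.

End Coinduced.

Lemma injective_embedding (R : pzRingType) (V : lmodType R) :
  exists (E : lmodType R) (i : {linear V -> E}), injective_module E /\ injective i.
Proof.
exists (coinduced R (divisible_hull V)), (coind_transpose (divisible_hull_class V)).
split; first exact/coinduced_injective/divisible_hull_divisible.
move=> x y /(congr1 (fun h : coinduced _ _ => h 1)) /=.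
by rewrite !scale1r; apply: divisible_hull_class_inj.
Qed.

(** * Chain conditions *)

Lemma exists_maximal (T : Type) (le : T -> T -> Prop) (Q : T -> Prop) (x0 : T) :
    (forall f : nat -> T, (forall n, Q (f n)) -> (forall n, le (f n) (f n.+1)) ->
       exists n, le (f n.+1) (f n)) ->
    Q x0 ->
  exists2 x, Q x & forall y, Q y -> le x y -> le y x.
Proof.
move=> chain_stops Qx0; apply: contrapT => no_max.
have above (x : {x | Q x}) : exists y : {y | Q y},
    le (sval x) (sval y) /\ ~ le (sval y) (sval x).
  apply: contrapT => no_y; apply: no_max; exists (sval x); first exact: svalP.
  move=> y Qy xy; apply: contrapT => yx; apply: no_y.
  by exists (exist _ y Qy).
have [next nextP] := choice above.
pose f n := sval (iter n next (exist _ x0 Qx0)).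
have [|n|n] := chain_stops f; first by move=> n; apply: svalP.
  exact: (nextP (iter n next _)).1.
exact: (nextP (iter n next _)).2.
Qed.

Lemma ascending_mono (T : Type) (S : nat -> T -> Prop) m n x :
  (forall k y, S k y -> S k.+1 y) -> (m <= n)%N -> S m x -> S n x.
Proof. by move=> S_asc /subnK <-; elim: (n - m)%N => [//|k IHk] /IHk; apply: S_asc. Qed.

Lemma descending_mono (T : Type) (S : nat -> T -> Prop) m n x :
  (forall k y, S k.+1 y -> S k y) -> (m <= n)%N -> S n x -> S m x.
Proof. by move=> S_desc /subnK <-; elim: (n - m)%N => [//|k IHk] /S_desc. Qed.

Definition noetherian_module (R : pzRingType) (V : lmodType R) : Prop :=
  forall S : nat -> V -> Prop, (forall n, is_submodule (S n)) ->
    (forall n x, S n x -> S n.+1 x) ->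
  exists n, forall m x, (n <= m)%N -> S m x -> S n x.

Definition artinian_module (R : pzRingType) (V : lmodType R) : Prop :=
  forall S : nat -> V -> Prop, (forall n, is_submodule (S n)) ->
    (forall n x, S n.+1 x -> S n x) ->
  exists n, forall m x, (n <= m)%N -> S n x -> S m x.

Definition fin_gen (R : pzRingType) (V : lmodType R) (S : V -> Prop) : Prop :=
  exists (I : finType) (x : I -> V), (forall i, S (x i)) /\
    forall v, S v -> exists t, v = lincomb x t.

Section ChainConditions.
Variable R : pzRingType.
Implicit Types U V W : lmodType R.

Lemma noetherian_maximal V (Q : (V -> Prop) -> Prop) S0 :
    noetherian_module V -> (forall S, Q S -> is_submodule S) -> Q S0 ->
  exists2 S, Q S & forall T, Q T -> (forall x, S x -> T x) -> forall x, T x -> S x.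
Proof.
move=> V_noeth Q_sub; apply: exists_maximal => S QS S_asc.
have [|n nP] := V_noeth S _ S_asc; first by move=> n; apply: Q_sub.
by exists n => x; apply: nP.
Qed.

Lemma artinian_minimal V (Q : (V -> Prop) -> Prop) S0 :
    artinian_module V -> (forall S, Q S -> is_submodule S) -> Q S0 ->
  exists2 S, Q S & forall T, Q T -> (forall x, T x -> S x) -> forall x, S x -> T x.
Proof.
move=> V_art Q_sub.
apply: (exists_maximal (le := fun S T => forall x, T x -> S x)) => S QS S_desc.
have [|n nP] := V_art S _ S_desc; first by move=> n; apply: Q_sub.
by exists n => x; apply: nP.
Qed.

Lemma artinian_finite_intersection V (X : Type) (P : X -> V -> Prop) :
    artinian_module V -> (forall x, is_submodule (P x)) ->
  exists (I : finType) (s : I -> X), forall v, (forall i, P (s i) v) -> forall x, P x v.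
Proof.
move=> V_art P_sub.
pose cap (I : finType) (s : I -> X) v := forall i, P (s i) v.
pose Q S := exists (I : finType) (s : I -> X), S = cap I s.
have [||_ [I [s ->]] s_min] := @artinian_minimal V Q (cap void (of_void X)) V_art.
- by move=> _ [I [s ->]]; apply: bigcap_submodule.
- by exists void, (of_void X).
exists I, s => v sv x; pose sx (i : I + unit) := if i is inl i then s i else x.
apply: (s_min (cap (I + unit)%type sx)) (inr tt) => //.
- by exists (I + unit)%type, sx.
- by move=> u ux i; apply: (ux (inl i)).
Qed.

Lemma noetherian_fin_gen V (S : V -> Prop) :
  noetherian_module V -> is_submodule S -> fin_gen S.
Proof.
move=> V_noeth S_sub.
pose Q T := [/\ is_submodule T, fin_gen T & forall x, T x -> S x].
have [||T [T_sub [I [x [Tx xP]]] TS] T_max] := @noetherian_maximal V Q (eq^~ 0) V_noeth.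
- by move=> T [].
- split; [exact: zero_submodule | | by move=> _ ->; apply: submodule0].
  exists void, (fun=> 0); split=> [[]|_ ->].
  by exists 0; rewrite linear0.
exists I, x; split=> [i|v Sv]; first exact: TS.
apply: (xP); apply: (T_max (adjoin T v)); last exact: mem_adjoin;
  last exact: sub_adjoin.
split; first exact: adjoin_submodule; last first.
  by move=> _ [y [r [Ty ->]]]; apply: submoduleD => //; [exact: TS | exact: submoduleZ].
exists (I + unit)%type, (fun i => if i is inl i then x i else v); split=> [[i|_]|].
- exact: sub_adjoin.
- exact: mem_adjoin.
move=> _ [y [r [/xP[t ->] ->]]].
exists [ffun i => if i is inl i then t i else r].
rewrite !lincombE big_sumType (big_pred1 tt) => [|[]//]; rewrite ffunE.
by congr (_ + _); apply: eq_bigr => i _; rewrite ffunE.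
Qed.

Lemma submodule_sub_extension U V W (i : {linear U -> V}) (p : {linear V -> W})
    (S T : V -> Prop) :
    is_submodule S -> is_submodule T -> (forall x, S x -> T x) ->
    (forall x, p x = 0 -> exists u, i u = x) ->
    (forall u, T (i u) -> S (i u)) -> (forall y, T y -> exists2 x, S x & p x = p y) ->
  forall y, T y -> S y.
Proof.
move=> S_sub T_sub ST ker_p iTS pTS y Ty; have [x Sx pxy] := pTS y Ty.
have [|u iu] := ker_p (y - x); first by rewrite linearB pxy subrr.
rewrite -(subrK x y) -iu; apply: submoduleD => //; apply: iTS; rewrite iu.
by apply: submoduleB => //; apply: ST.
Qed.

Lemma noetherian_extension U V W (i : {linear U -> V}) (p : {linear V -> W}) :
    (forall x, p x = 0 -> exists u, i u = x) ->
  noetherian_module U -> noetherian_module W -> noetherian_module V.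
Proof.
move=> ker_p U_noeth W_noeth S S_sub S_asc.
have [||k kP] := U_noeth (fun n u => S n (i u)).
- by move=> n; apply: preim_submodule.
- by move=> n u; apply: S_asc.
have [||l lP] := W_noeth (fun n w => exists2 v, S n v & p v = w).
- by move=> n; apply: image_submodule.
- by move=> n _ [v Sv <-]; exists v => //; apply: S_asc.
exists (maxn k l) => m x klm; have [km lm] : (k <= m)%N /\ (l <= m)%N.
  by apply/andP; rewrite -geq_max.
apply: (submodule_sub_extension _ _ _ ker_p) => // [y|u Su|y Sy].
- exact: ascending_mono.
- exact: (ascending_mono S_asc (leq_maxl k l) (kP m u km Su)).
have [|v Sv <-] := lP m (p y) lm; first by exists y.
by exists v => //; apply: (ascending_mono S_asc (leq_maxr k l)).
Qed.

Lemma noetherian_surjection V W (p : {linear V -> W}) :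
  (forall w, exists v, p v = w) -> noetherian_module V -> noetherian_module W.
Proof.
move=> p_surj V_noeth S S_sub S_asc.
have [||n nP] := V_noeth (fun n v => S n (p v)).
- by move=> n; apply: preim_submodule.
- by move=> n v; apply: S_asc.
by exists n => m x nm; have [v <-] := p_surj x; apply: nP.
Qed.

Lemma noetherian_free_ord : noetherian_module (R^o : lmodType R) -> forall n,
  noetherian_module ({ffun 'I_n -> R^o} : lmodType R).
Proof.
move=> R_noeth; elim=> [|n IHn].
  move=> S S_sub _; exists 0%N => m x _ _.
  by have -> : x = 0 by [apply/ffunP => -[]]; apply: submodule0.
have tail_lin : linear (fun u : {ffun 'I_n -> R^o} =>
    [ffun k => if unlift ord0 k is Some j then u j else 0] : {ffun 'I_n.+1 -> R^o}).
  move=> r u v; apply/ffunP => k; rewrite !ffunE.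
  by case: unlift => [j|]; rewrite ?ffunE // scaler0 addr0.
have head_lin : linear (fun v : {ffun 'I_n.+1 -> R^o} => v ord0).
  by move=> r u v; rewrite !ffunE.
apply: (noetherian_extension (i := linear_fun tail_lin)
  (p := linear_fun head_lin)) => //.
move=> x x0; exists [ffun j => x (fintype.lift ord0 j)].
apply/ffunP => k; rewrite !ffunE.
by case: unliftP => [j ->|->]; rewrite ?ffunE.
Qed.

Lemma noetherian_free (I : finType) : noetherian_module (R^o : lmodType R) ->
  noetherian_module ({ffun I -> R^o} : lmodType R).
Proof.
move=> /noetherian_free_ord/(_ #|I|).
have reindex_lin :
    linear (fun u : {ffun 'I_#|I| -> R^o} => [ffun i => u (enum_rank i)]).
  by move=> r u v; apply/ffunP => i; rewrite !ffunE.
apply: (noetherian_surjection (p := linear_fun reindex_lin)) => w.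
by exists [ffun j => w (enum_val j)]; apply/ffunP => i; rewrite !ffunE enum_rankK.
Qed.

End ChainConditions.

(** * Simple submodules over a left noetherian left self-injective ring *)

(* [m] generates a simple submodule. *)
Definition simple_elt (R : pzRingType) (M : lmodType R) (m : M) : Prop :=
  m <> 0 /\ forall t : R, t *: m <> 0 -> exists s : R, s *: (t *: m) = m.

Definition semiartinian (R : pzRingType) : Prop :=
  forall (M : lmodType R) (m : M), m <> 0 -> exists t : R, simple_elt (t *: m).

(* The annihilator of the submodule generated by [m]. *)
Definition annihilator (R : pzRingType) (M : lmodType R) (m : M) : R -> Prop :=
  fun r => forall s : R, r *: (s *: m) = 0.

Definition module_annihilator (R : pzRingType) (N : lmodType R) (r : R) : Prop :=
  forall n : N, r *: n = 0.

Definition prime_module (R : pzRingType) (N : lmodType R) : Prop :=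
  forall (n : N) (r : R), n <> 0 -> annihilator n r -> module_annihilator N r.

Section PrimeModule.
Variables (R : pzRingType) (N : lmodType R).
Hypothesis N_prime : prime_module N.
Let kills : R -> Prop := module_annihilator N.

Lemma module_annihilatorPn (a : R) : ~ kills a -> exists n : N, a *: n <> 0.
Proof.
move=> nka; apply: contrapT => no_n; apply: nka => n.
by apply: contrapT => an; apply: no_n; exists n.
Qed.

Lemma prime_module_scale (a : R) (n : N) : ~ kills a -> n <> 0 ->
  exists u : R, a *: (u *: n) <> 0.
Proof.
move=> nka n_neq0; apply: contrapT => no_u; apply: nka; apply: (N_prime n_neq0) => u.
by apply: contrapT => aun; apply: no_u; exists u.
Qed.

(* [a R] is a minimal right ideal modulo the annihilator of [N]. *)
Definition right_minimal (a : R) : Prop :=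
  ~ kills a /\ forall t, ~ kills (a * t) -> exists s, a = a * t * s.

(* Take [b = u a], where [a u a] does not annihilate [N]. *)
Lemma right_minimal_von_neumann (a : R) : right_minimal a ->
  exists b w, right_minimal b /\ forall n : N, (b * w * b) *: n = b *: n.
Proof.
move=> [nka a_min]; have [n0 an0] := module_annihilatorPn nka.
have [u auan0] := prime_module_scale nka an0.
have kills_mul x t : kills x -> kills (x * t) by move=> kx n; rewrite -scalerA.
have nkaua : ~ kills (a * (u * a)) by move/(_ n0); rewrite -!scalerA.
have [w aw] := a_min _ nkaua; exists (u * a), w.
have ua_min : right_minimal (u * a).
  split=> [kua|t nkuat].
    by apply: nkaua => n; rewrite -scalerA kua scaler0.
  have [|s a_ats] := a_min t; last by exists s; rewrite {1}a_ats !mulrA.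
  by move=> kat; apply: nkuat => n; rewrite -mulrA -scalerA kat scaler0.
split=> // n; apply/eqP; rewrite -subr_eq0 -scalerBl; apply/eqP; move: n.
apply: contrapT.
have -> : u * a * w * (u * a) - u * a = u * a * (w * u * a - 1).
  by rewrite mulrBr mulr1 !mulrA.
move=> /ua_min.2[s ua_s]; apply: nkaua; rewrite ua_s mulrA; apply: kills_mul.
rewrite !mulrA in aw; rewrite !mulrBr mulr1 !mulrA -aw subrr => n; exact: scale0r.
Qed.

Lemma right_minimal_left_inverse (b w t : R) : right_minimal b ->
    (forall n : N, (b * w * b) *: n = b *: n) -> ~ kills (b * t * b) ->
  exists s : R, forall n : N, b *: (s *: (b *: (t *: (b *: n)))) = b *: n.
Proof.
move=> b_min bwb; have right_inverse r : ~ kills (b * r * b) ->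
    exists s : R, forall n : N, b *: (r *: (b *: (s *: (b *: n)))) = b *: n.
  rewrite -mulrA => /b_min.2[s bE]; exists (s * w) => n.
  apply: etrans (bwb n); rewrite !scalerA; congr (_ *: _).
  by rewrite [X in _ = X * _ * _]bE !mulrA.
move=> /right_inverse[s btbs]; have [|s' bsbs'] := right_inverse s.
  move=> kbsb; have [n bn] := module_annihilatorPn b_min.1; apply: bn.
  have bsb : b *: (s *: (b *: n)) = 0 by rewrite !scalerA; apply: kbsb.
  by rewrite -btbs bsb !scaler0.
by exists s => n; rewrite -[in LHS](bsbs' n) btbs bsbs'.
Qed.

Lemma prime_module_simple (a : R) : right_minimal a -> exists n : N, simple_elt n.
Proof.
move=> /right_minimal_von_neumann[b [w [b_min bwb]]].
have [y by_neq0] := module_annihilatorPn b_min.1; exists (b *: y); split=> // t tby.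
have [u ubt] := prime_module_scale b_min.1 tby.
have [|s sE] := right_minimal_left_inverse (t := u * t) b_min bwb.
  by move=> kills_b; apply: ubt; rewrite -(kills_b y) !scalerA !mulrA.
by exists (b * s * b * u); rewrite -[RHS]sE !scalerA !mulrA.
Qed.

End PrimeModule.

Section Annihilator.
Variable R : pzRingType.

Definition two_sided (P : R -> Prop) : Prop :=
  is_submodule (P : R^o -> Prop) /\ forall x r, P x -> P (x * r).

Definition maximal_ideal (P : R -> Prop) : Prop :=
  [/\ two_sided P, ~ P 1 & forall Q, two_sided Q -> ~ Q 1 ->
    (forall r, P r -> Q r) -> forall r, Q r -> P r].

Lemma annihilator_two_sided (M : lmodType R) (m : M) : two_sided (annihilator m).
Proof.
split=> [|r t Ar s]; last by rewrite -scalerA (scalerA t) Ar.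
by apply: bigcap_submodule => s; apply: (ker_submodule (scale_map (s *: m))).
Qed.

Lemma simple_elt_scale (M : lmodType R) (m : M) (c : R) :
  simple_elt m -> c *: m <> 0 -> simple_elt (c *: m).
Proof.
move=> [m_neq0 m_simple] cm; split=> // t tcm.
have [|s sE] := m_simple (t * c); first by rewrite -scalerA.
by exists (c * s); rewrite -scalerA (scalerA t) sE.
Qed.

Lemma simple_elt_annihilator_max (M N : lmodType R) (m : M) (n : N) :
    simple_elt m -> n <> 0 -> (forall r : R, r *: m = 0 -> r *: n = 0) ->
  forall r : R, r *: n = 0 -> r *: m = 0.
Proof.
move=> [_ m_simple] n_neq0 mn r rn; apply: contrapT => /m_simple[s sE].
apply: n_neq0; have /mn : (s * r - 1) *: m = 0.
  by rewrite scalerBl -scalerA sE scale1r subrr.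
by rewrite scalerBl -scalerA rn scaler0 scale1r sub0r => /eqP; rewrite oppr_eq0 => /eqP.
Qed.

Lemma maximal_ideal_eq (P Q : R -> Prop) : maximal_ideal P -> two_sided Q -> ~ Q 1 ->
  (forall r, P r -> Q r) -> P = Q.
Proof.
move=> [_ _ P_max] Q_ideal nQ1 PQ; apply/predeqP => r; split; first exact: PQ.
exact: P_max.
Qed.

Lemma maximal_ideal_comaximal (P Q : R -> Prop) : maximal_ideal P -> maximal_ideal Q ->
  P <> Q -> exists c d, [/\ P c, Q d & c + d = 1].
Proof.
move=> P_max Q_max PQ; have [[P_sub P_mul] _ _] := P_max.
have [[Q_sub Q_mul] nQ1 _] := Q_max.
pose PQ_sum r := exists c d, [/\ P c, Q d & c + d = r].
have PQ_ideal : two_sided PQ_sum.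
  split=> [|_ r [c [d [Pc Qd <-]]]]; last first.
    by exists (c * r), (d * r); rewrite -mulrDl; split; [exact: P_mul | exact: Q_mul |].
  split=> [|_ _ [c [d [Pc Qd <-]]] [c' [d' [Pc' Qd' <-]]]|r _ [c [d [Pc Qd <-]]]].
  - exists 0, 0; rewrite addr0.
    by split=> //; [exact: submodule0 P_sub | exact: submodule0 Q_sub].
  - exists (c + c'), (d + d'); rewrite addrACA.
    by split=> //; [exact: (submoduleD P_sub) | exact: (submoduleD Q_sub)].
  exists (r * c), (r * d); rewrite -mulrDr.
  by split=> //; [exact: (submoduleZ P_sub) | exact: (submoduleZ Q_sub)].
apply: contrapT => nPQ1; apply: PQ.
have P_in r : P r -> PQ_sum r.
  by move=> Pr; exists r, 0; rewrite addr0; split=> //; exact: submodule0 Q_sub.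
have Q_in r : Q r -> PQ_sum r.
  by move=> Qr; exists 0, r; rewrite add0r; split=> //; exact: submodule0 P_sub.
by rewrite (maximal_ideal_eq P_max PQ_ideal) // -(maximal_ideal_eq Q_max PQ_ideal).
Qed.

(* The descending chain of the intersections of the first [n] ideals stops, so
   some [p n] contains the product of its predecessors. *)
Lemma maximal_ideals_repeat (p : nat -> R -> Prop) :
    artinian_module (R^o : lmodType R) -> (forall k, maximal_ideal (p k)) ->
  exists i j, (i < j)%N /\ p i = p j.
Proof.
move=> R_art p_max; apply: contrapT => no_repeat.
pose D n (r : R^o) := forall i : 'I_n, p i r.
have [n|n r Dr i|n Dn] := R_art D.
- by apply: bigcap_submodule => i; case: (p_max i) => -[].
- exact: (Dr (widen_ord (leqnSn n) i)).
have [[pn_sub pn_mul] npn1 _] := p_max n.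
have D_comax k : (k <= n)%N -> exists c d, [/\ D k c, p n d & c + d = 1].
  elim: k => [_|k IHk kn].
    by exists 1, 0; split; [case | exact: submodule0 pn_sub | exact: addr0].
  have [c [d [Dc pd cd]]] := IHk (ltnW kn).
  have [|c' [d' [pc' pd' cd']]] := maximal_ideal_comaximal (p_max k) (p_max n).
    by move=> pkn; apply: no_repeat; exists k, n.
  exists (c * c'), (c * d' + d); split.
  - move=> i; have [ik|ki] := ltnP i k; last first.
      have -> : p i = p k by congr p; apply/eqP; rewrite eqn_leq ki -ltnS ltn_ord.
      by case: (p_max k) => -[pk_sub _] _ _; apply: (submoduleZ pk_sub).
    by case: (p_max i) => -[_ pi_mul] _ _; apply/pi_mul/(Dc (Ordinal ik)).
  - exact: (submoduleD pn_sub (submoduleZ pn_sub c pd') pd).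
  by rewrite addrA -mulrDr cd' mulr1.
have [c [d [Dc pd cd]]] := D_comax n (leqnn n); apply: npn1; rewrite -cd.
by apply: (submoduleD pn_sub) pd; apply: (Dn n.+1 c (leqnSn n) Dc ord_max).
Qed.

End Annihilator.

(* Choose [t *: m] so that its annihilator is maximal. *)
Lemma prime_cyclic_submodule (R : pzRingType) (M : lmodType R) (m : M) :
    noetherian_module (R^o : lmodType R) -> m <> 0 ->
  exists t : R, t *: m <> 0 /\
    prime_module (submod (range_submodule (scale_map (t *: m)))).
Proof.
move=> R_noeth m_neq0.
pose Q (A : R^o -> Prop) := exists2 t : R, t *: m <> 0 & A = annihilator (t *: m).
have [_ [t _ ->]||_ [t x_neq0 ->]] :=
  @noetherian_maximal _ _ Q (annihilator m) R_noeth.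
- by case: (annihilator_two_sided (t *: m)).
- by exists 1; rewrite scale1r.
set x := t *: m in x_neq0 * => x_max; exists t; split=> // n r n_neq0 rn n'.
have [s sx] := submodP n; have [s' s'x] := submodP n'.
apply: val_inj; rewrite /= -s'x; apply: (x_max (annihilator (s *: x))).
- exists (s * t); last by rewrite scalerA.
  rewrite -scalerA -[_ *: _]/(scale_map x s) sx => n0; apply: n_neq0.
  exact: val_inj.
- by move=> r' r'x s1; rewrite (scalerA s1).
by move=> s1; have /(congr1 (@submod_val _ _ _ _)) := rn s1; rewrite /= -sx.
Qed.

Section SelfInjective.
Variable R : pzRingType.
Hypothesis R_inj : injective_module (R^o : lmodType R).

Lemma linear_form_span (V : lmodType R) (K : finType) (phi : K -> {linear V -> R^o})
    (psi : {linear V -> R^o}) : (forall v, (forall k, phi k v = 0) -> psi v = 0) ->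
  exists w : K -> R, forall v, psi v = \sum_k (phi k v : R) * w k.
Proof.
move=> ker_sub; have phi_lin : linear (fun v => [ffun k => phi k v] : {ffun K -> R^o}).
  by move=> r u v; apply/ffunP => k; rewrite !ffunE linearP.
have [|g gE] := factor_injective (u := linear_fun phi_lin) (f := psi) R_inj.
  by move=> v /ffunP phi0; apply: ker_sub => k; have := phi0 k; rewrite !ffunE.
exists (fun k => g (basis_vec R k)) => v; rewrite -gE /= [X in g X]sum_basis_vec.
by rewrite linear_sum; apply: eq_bigr => k _; rewrite linearZ_LR ffunE.
Qed.

Lemma right_double_annihilator (K : finType) (x : K -> R) (y : R) :
    (forall t, (forall k, t * x k = 0) -> t * y = 0) ->
  exists w : K -> R, y = \sum_k x k * w k.
Proof.
move=> xy; have [//|w wE] := linear_form_span (phi := fun k => scale_map (x k : R^o))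
  (psi := scale_map (y : R^o)).
exists w; rewrite -[LHS](mul1r y) [LHS](wE 1); apply: eq_bigr => k _.
by rewrite -[X in X * _]/(1 * x k) mul1r.
Qed.

Lemma principal_right_double_annihilator (x y : R) :
  (forall t, t * x = 0 -> t * y = 0) -> exists w, y = x * w.
Proof.
move=> xy; have [|w ->] := right_double_annihilator (x := fun _ : unit => x) (y := y).
  by move=> t /(_ tt); apply: xy.
by exists (w tt); rewrite (big_pred1 tt) // => -[].
Qed.

Hypothesis R_noeth : noetherian_module (R^o : lmodType R).

Lemma principal_right_minimal (Q : R -> Prop) (a0 : R) : Q a0 ->
  exists2 a, Q a & forall t, Q (a * t) -> exists s, a = a * t * s.
Proof.
pose le (a b : R) := exists t, b = a * t.
move=> /(exists_maximal (le := le))[a _ a_le|a Qa a_max]; last first.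
  by exists a => // t Qat; apply: a_max Qat _; exists t.
have [|n r|n nP] := R_noeth (S := fun n (r : R^o) => r * a n = 0).
- by move=> n; apply: (ker_submodule (scale_map (a n : R^o))).
- by have [t ->] := a_le n; rewrite mulrA => ->; rewrite mul0r.
exists n; apply: principal_right_double_annihilator => r.
exact: (nP n.+1 r (leqnSn n)).
Qed.

Lemma self_injective_semiartinian : semiartinian R.
Proof.
move=> M m0 /(prime_cyclic_submodule R_noeth)[t0 [x_neq0]].
set x := t0 *: m0 in x_neq0 *; set N := submod _ => N_prime.
pose x_N : N := submod_in (range_submodule (scale_map x)) (ex_intro _ 1 (scale1r x)).
have [|a nka a_min] :=
  principal_right_minimal (Q := fun a => ~ module_annihilator N a) (a0 := 1).
  by move=> /(_ x_N) /(congr1 (@submod_val _ _ _ _)); rewrite /= !scale1r.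
have [n [n_neq0 n_simple]] := prime_module_simple N_prime (conj nka a_min).
have [s sx] := submodP n; exists (s * t0).
rewrite -scalerA -[_ *: _]/(scale_map x s) sx.
split=> [n0|t tn]; first by apply: n_neq0; apply: val_inj.
have [|s1 s1tn] := n_simple t; first by move=> /(congr1 (@submod_val _ _ _ _)).
by exists s1; rewrite -[in RHS]s1tn.
Qed.

End SelfInjective.

Section DescendingChain.
Variables (R : pzRingType) (V : lmodType R) (S : nat -> V -> Prop).
Hypothesis S_sub : forall n, is_submodule (S n).
Hypothesis S_desc : forall n x, S n.+1 x -> S n x.

Definition stabilizes_on (C : V -> Prop) : Prop :=
  exists n, forall m x, (n <= m)%N -> C x -> S n x -> S m x.

Lemma stabilizes_on_adjoin (C : V -> Prop) (C_sub : is_submodule C) (t : V) :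
  simple_elt (quotmod_pi C_sub t) -> stabilizes_on C -> stabilizes_on (adjoin C t).
Proof.
set pi := quotmod_pi C_sub; move=> [_ t_simple] [n nP].
have pi0 x : pi x = 0 <-> C x by apply: quotmod_pi_eq0.
have [[k kP]|stays] := pselect (exists k, forall x, adjoin C t x -> S k x -> C x).
  exists (maxn k n) => m x; rewrite geq_max => /andP[km nm] C'x Sx.
  apply: nP (descending_mono S_desc (leq_maxr k n) Sx) => //.
  exact: kP (descending_mono S_desc (leq_maxl k n) Sx).
exists n => m x nm [c [r [Cc xE]]] Sx.
have [y [v [Sy vy]]] : exists y v, S m y /\ v *: pi y = pi t.
  apply: contrapT => no_y; apply: stays; exists m => _ [d [s [Cd ->]]] Sy.
  apply: contrapT => nCy; apply: no_y; exists (d + s *: t).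
  have piE : pi (d + s *: t) = s *: pi t by rewrite linearD linearZ_LR (pi0 d).2 ?add0r.
  have [|v vE] := t_simple s; first by rewrite -piE => /pi0.
  by exists v; rewrite piE.
have Cdiff : C (x - (r * v) *: y).
  apply/pi0; rewrite xE (linearB pi) (linearD pi) !(linearZ_LR pi) (pi0 c).2 //.
  by rewrite add0r -scalerA vy subrr.
rewrite -(subrK ((r * v) *: y) x); have Srvy := submoduleZ (S_sub m) (r * v) Sy.
apply: (submoduleD (S_sub m)) Srvy; apply: nP => //.
apply: (submoduleB (S_sub n)) => //.
exact: descending_mono (submoduleZ (S_sub m) (r * v) Sy).
Qed.

End DescendingChain.

Lemma noetherian_artinian (R : pzRingType) (V : lmodType R) :
  semiartinian R -> noetherian_module V -> artinian_module V.
Proof.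
move=> R_semi V_noeth S S_sub S_desc.
pose Q C := is_submodule C /\ stabilizes_on S C.
have [||C [C_sub C_stab] C_max] := @noetherian_maximal _ V Q (eq^~ 0) V_noeth.
- by move=> C [].
- by split; [exact: zero_submodule | exists 0%N => m _ _ -> _; apply: submodule0].
suff C_full x : C x by have [n nP] := C_stab; exists n => m x nm; apply: nP.
apply: contrapT => nCx.
have [|r rx_simple] := R_semi _ (quotmod_pi C_sub x); first by move=> /quotmod_pi_eq0.
rewrite -linearZ_LR in rx_simple; apply: rx_simple.1; apply/quotmod_pi_eq0.
apply: (C_max (adjoin C (r *: x))); last exact: mem_adjoin; last exact: sub_adjoin.
by split; [exact: adjoin_submodule | exact: stabilizes_on_adjoin].
Qed.

Section ArtinianRing.
Variable R : pzRingType.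
Hypotheses (R_art : artinian_module (R^o : lmodType R)) (R_semi : semiartinian R).

(* A left ideal that is minimal among those not annihilating [y] meets the
   annihilator of some [s *: m] inside the annihilator of [y]. *)
Lemma simple_elt_iso (M N : lmodType R) (m : M) (y : N) :
    simple_elt m -> simple_elt y -> (forall r, annihilator m r -> r *: y = 0) ->
  exists2 c : R, c *: m <> 0 & forall r : R, r *: (c *: m) = 0 <-> r *: y = 0.
Proof.
move=> m_simple [y_neq0 y_simple] my.
pose Q (L : R^o -> Prop) := is_submodule L /\ exists2 t : R, L t & t *: y <> 0.
have [||L [L_sub [t Lt ty]] L_min] := @artinian_minimal _ _ Q (fun=> True) R_art.
- by move=> L [].
- by split=> //; exists 1 => //; rewrite scale1r.
have [s [t' [Lt' t'sm]]] : exists s t' : R, L t' /\ t' *: (s *: m) <> 0.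
  apply: contrapT => no_s; apply: ty; apply: my => s.
  by apply: contrapT => tsm; apply: no_s; exists s, t.
have Ly (r : R) : L r -> r *: (s *: m) = 0 -> r *: y = 0.
  move=> Lr rsm; apply: contrapT => ry; apply: t'sm.
  apply: (L_min (fun r => L r /\ r *: (s *: m) = 0) _ _ _ Lt').2 => [|r' []//].
  split; last by exists r.
  by apply: meet_submodule => //; apply: (ker_submodule (scale_map (s *: m))).
have [v vty] := y_simple t ty; pose c := v * t * s.
have cy r : r *: (c *: m) = 0 -> r *: y = 0.
  move=> rcm; rewrite -vty !scalerA; apply: Ly; first exact: (submoduleZ L_sub).
  by rewrite -rcm /c !scalerA !mulrA.
have c_neq0 : c *: m <> 0.
  by move=> cm; apply: y_neq0; rewrite -[y]scale1r cy // cm scaler0.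
exists c => // r; split; first exact: cy.
exact: simple_elt_annihilator_max (simple_elt_scale m_simple c_neq0) y_neq0 cy r.
Qed.

Lemma simple_elt_maximal_ideal (M : lmodType R) (m : M) :
  simple_elt m -> maximal_ideal (annihilator m).
Proof.
move=> m_simple; split; first exact: annihilator_two_sided.
  by move=> /(_ 1); rewrite !scale1r; apply: m_simple.1.
move=> q [q_sub q_mul] nq1 mq r qr s.
have [|t y_simple] := R_semi (m := quotmod_pi q_sub 1); first by move=> /quotmod_pi_eq0.
set y := t *: _ in y_simple.
have qy r' : q r' -> r' *: y = 0.
  move=> qr'; rewrite /y -!linearZ_LR; apply/quotmod_pi_eq0.
  by rewrite -[_ *: _]/(r' * (t * 1)); apply: q_mul.
have [|c c_neq0 cP] := simple_elt_iso m_simple y_simple; first by move=> r' /mq/qy.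
have [v vcm] := m_simple.2 c c_neq0.
by rewrite -vcm !scalerA -scalerA; apply/cP/qy/q_mul/q_mul.
Qed.

Hypothesis R_inj : injective_module (R^o : lmodType R).

Lemma two_sided_left_annihilator (p : R -> Prop) : two_sided p -> ~ p 1 ->
  exists2 a : R, simple_elt (a : R^o) & forall x, p x -> a * x = 0.
Proof.
move=> [p_sub p_mul] np1.
have [|I [s sP]] := artinian_finite_intersection
  (P := fun (x : {x | p x}) (r : R^o) => r * sval x = 0) R_art.
  by move=> x; apply: (ker_submodule (scale_map (sval x : R^o))).
have [b b_neq0 bs] : exists2 b : R, b <> 0 & forall i, b * sval (s i) = 0.
  apply: contrapT => no_b; apply: np1.
  have [|w ->] := right_double_annihilator R_inj (x := fun i => sval (s i)) (y := 1).
    by move=> t ts; rewrite mulr1; apply: contrapT => t_neq0; apply: no_b; exists t.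
  by apply: (submodule_sum p_sub) => i _; apply/p_mul/svalP.
have [t t_simple] := @R_semi R^o b b_neq0.
exists (t * b) => // x px; rewrite -mulrA.
by have /= -> := sP b bs (exist _ x px); rewrite mulr0.
Qed.

(* The graph of the Nakayama permutation of the maximal ideals. *)
Definition nakayama (p q : R -> Prop) : Prop :=
  exists a : R, [/\ simple_elt (a : R^o), forall x, p x -> a * x = 0 &
    q = annihilator (a : R^o)].

Lemma nakayama_injective (p p' q : R -> Prop) : maximal_ideal p -> maximal_ideal p' ->
  nakayama p q -> nakayama p' q -> p = p'.
Proof.
move=> p_max p'_max [a [a_simple ap ->]] [a' [a'_simple a'p' eq_ann]].
have [|c c_neq0 cP] := simple_elt_iso a_simple a'_simple.
  by rewrite eq_ann => r /(_ 1); rewrite scale1r.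
have [|w wE] := principal_right_double_annihilator R_inj (x := a') (y := c * a).
  by move=> t /cP.
have [v vE] := a_simple.2 c c_neq0.
pose q0 (t : R) := forall s, a * (s * t) = 0.
have q0_ideal : two_sided q0.
  split=> [|t r q0t s]; last by rewrite [s * _]mulrA mulrA q0t mul0r.
  split=> [s|t t' q0t q0t' s|r t q0t s]; first by rewrite !mulr0.
    by rewrite !mulrDr q0t q0t' addr0.
  by rewrite [s * _]mulrA q0t.
have nq0_1 : ~ q0 1 by move=> /(_ 1); rewrite !mulr1; apply: a_simple.1.
rewrite (maximal_ideal_eq p_max q0_ideal) // => [|x px s]; last first.
  by have [[p_sub _] _ _] := p_max; apply/ap/(submoduleZ p_sub s).
apply/esym/maximal_ideal_eq => // x p'x s.
rewrite -vE -[_ *: _]/(v * (c * a)) wE -!mulrA a'p' ?mulr0 // mulrA.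
by have [[p'_sub _] _ _] := p'_max; apply: (submoduleZ p'_sub).
Qed.

Lemma nakayama_exists (p : R -> Prop) : maximal_ideal p ->
  exists2 q, maximal_ideal q & nakayama p q.
Proof.
move=> [p_ideal np1 _]; have [a a_simple ap] := two_sided_left_annihilator p_ideal np1.
by exists (annihilator (a : R^o)); [exact: simple_elt_maximal_ideal | exists a].
Qed.

(* A sequence of iterates of an injective map that repeats a value returns to its
   first term. *)
Lemma nakayama_surjective (q : R -> Prop) : maximal_ideal q ->
  exists2 p, maximal_ideal p & nakayama p q.
Proof.
move=> q_max.
have next_exists (p : {p : R -> Prop | maximal_ideal p}) :
    exists q : {q : R -> Prop | maximal_ideal q}, nakayama (sval p) (sval q).
  by have [q' q'_max pq'] := nakayama_exists (svalP p); exists (exist _ q' q'_max).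
have [next nextP] := choice next_exists.
pose p k := iter k next (exist _ q q_max).
have [i [j [ltij pij]]] := maximal_ideals_repeat R_art (fun k => svalP (p k)).
have cancel_next k l : sval (p k.+1) = sval (p l.+1) -> sval (p k) = sval (p l).
  move=> pkl; apply: (nakayama_injective (svalP (p k)) (svalP (p l)) (nextP (p k))).
  by rewrite -[sval (next _)]/(sval (p k.+1)) pkl; apply: nextP.
suff : sval (p (j - i)%N) = q.
  case: (j - i)%N (subn_gt0 i j) => [|k _ <-]; first by rewrite ltij.
  by exists (sval (p k)); [exact: svalP | exact: nextP].
elim: i j ltij pij => [|i IHi] [|j] // ltij pij.
by rewrite subSS; apply: IHi => //; apply: cancel_next.
Qed.

Lemma self_injective_artinian_kasch (M : lmodType R) (m : M) : simple_elt m ->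
  exists2 a : R, a <> 0 & forall r : R, r *: m = 0 -> r * a = 0.
Proof.
move=> m_simple.
have [p _ [a [a_simple _ ann_eq]]] :=
  nakayama_surjective (simple_elt_maximal_ideal m_simple).
have [|c c_neq0 cP] := simple_elt_iso a_simple m_simple.
  by rewrite -ann_eq => r /(_ 1); rewrite scale1r.
by exists (c * a) => // r /cP.
Qed.

Lemma exists_linear_form (M : lmodType R) (m : M) : m <> 0 ->
  exists g : {linear M -> R^o}, g m <> 0.
Proof.
move=> /R_semi[t /self_injective_artinian_kasch[a a_neq0 ma]].
have [|g gE] := factor_injective (u := scale_map (t *: m))
  (f := scale_map (a : R^o)) R_inj; first exact: ma.
exists g => gm0; apply: a_neq0; have /= := gE 1.
by rewrite scale1r linearZ_LR gm0 scaler0 => ->; apply/esym/mul1r.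
Qed.

Lemma function_module_embedding (M : lmodType R) :
  exists (X : Type) (h : {linear M -> (X -> R^o)}), injective h.
Proof.
have eval_lin : linear (fun m (g : {linear M -> R^o}) => g m).
  by move=> r m n; apply/funext => g; apply: linearP.
exists {linear M -> R^o}, (linear_fun eval_lin); apply: raddf_inj => m eval0.
apply: contrapT => /exists_linear_form[g]; apply.
exact: (congr1 (fun e => e g) eval0).
Qed.

End ArtinianRing.

(** * Quasi-Frobenius rings *)

Lemma eq_flat_factor_fin_presented (R : pzRingType) (F V : lmodType R) (J : finType)
    (u : {linear {ffun J -> R^o} -> V}) (f : {linear {ffun J -> R^o} -> F}) :
    eq_flat F -> fin_gen (fun t => u t = 0) -> (forall t, u t = 0 -> f t = 0) ->
  exists (K : finType) (y : K -> F) (c : K -> {linear {ffun J -> R^o} -> R^o}),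
    (forall t, f t = \sum_k (c k t : R) *: y k) /\
    (forall k t, u t = 0 -> c k t = 0).
Proof.
move=> F_flat [L [rel [u_rel relP]]] ker_sub.
have f_lincomb t : f t = \sum_j (t j : R) *: f (basis_vec R j).
  by rewrite {1}[t]sum_basis_vec linear_sum; apply: eq_bigr => j _; rewrite linearZ_LR.
have [|K [y [c [fE relc]]]] :=
  F_flat J L (fun l j => rel l j) (fun j => f (basis_vec R j)).
  by move=> l; rewrite -f_lincomb ker_sub.
exists K, y, (fun k => lincomb (fun j => c j k : R^o)); split=> [t|k t /relP[s ->]].
  rewrite f_lincomb; under eq_bigr do rewrite fE scaler_sumr.
  rewrite exchange_big; apply: eq_bigr => k _; rewrite lincombE scaler_suml.
  by apply: eq_bigr => j _; rewrite scalerA.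
by rewrite linear_lincomb lincombE big1 // => l _; rewrite /= relc scaler0.
Qed.

Section QuasiFrobenius.
Variable R : pzRingType.
Hypotheses (R_noeth : noetherian_module (R^o : lmodType R))
  (R_inj : injective_module (R^o : lmodType R)).

(* Left ideals are finitely presented, so a map from one of them to a flat module
   factors through a finite free module, to which injectivity of the ring applies. *)
Lemma self_injective_eq_flat_injective (F : lmodType R) :
  eq_flat F -> injective_module F.
Proof.
move=> F_flat; apply: baer => I I_sub f.
have [J [x [Ix xP]]] := noetherian_fin_gen R_noeth I_sub.
pose u := lincomb x; have Iu t : I (u t).
  by apply: (submodule_sum I_sub) => j _; apply: (submoduleZ I_sub).
pose uI := submod_corestr I_sub Iu.
have [||K [y [c [fE c0]]]] :=
  eq_flat_factor_fin_presented (u := u) (f := f \o uI) F_flat.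
- exact: noetherian_fin_gen (noetherian_free R_noeth) (ker_submodule u).
- by move=> t ut0; rewrite -(linear0 f) -[LHS]/(f (uI t)); congr (f _); apply: val_inj.
have [g gE] := choice (fun k => factor_injective R_inj (c0 k)).
exists (\sum_k (g k 1 : R) *: y k) => r; have [t rE] := xP _ (submodP r).
have -> : r = uI t by apply: val_inj.
rewrite -[f _]/((f \o uI) t) fE scaler_sumr; apply: eq_bigr => k _; rewrite -gE scalerA.
congr (_ *: _); rewrite -[RHS]/(_ *: g k 1) -linearZ_LR; congr (g k _).
exact/esym/mulr1.
Qed.

Lemma self_injective_artinian_free (I : finType) :
  artinian_module ({ffun I -> R^o} : lmodType R).
Proof.
exact/(noetherian_artinian (self_injective_semiartinian R_inj R_noeth))/noetherian_free.
Qed.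

(* The solutions of a finite linear system form a finitely generated right module. *)
Lemma self_injective_eq_flat_function_module (X : Type) :
  eq_flat (X -> R^o : lmodType R).
Proof.
move=> I J a x ax0.
pose sol (c : I -> R) := forall j, \sum_i a j i * c i = 0.
have [|K [s sP]] := artinian_finite_intersection
  (P := fun (c : {c | sol c}) t => lincomb (sval c : I -> R^o) t = 0)
  (@self_injective_artinian_free I); first by move=> c; apply: ker_submodule.
have coef_exists q : exists w : K -> R, forall i, x i q = \sum_k sval (s k) i * w k.
  have x_sol : sol (fun i => x i q).
    by move=> j; have := congr1 (fun h => h q) (ax0 j); rewrite fct_sumE.
  have [|w wE] := linear_form_span R_inj
      (phi := fun k => lincomb (sval (s k) : I -> R^o)) (psi := lincomb (fun i => x i q)).
    by move=> t /sP/(_ (exist _ _ x_sol)).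
  exists w => i; have := wE (basis_vec R i); rewrite lincomb_basis_vec.
  by under eq_bigr do rewrite lincomb_basis_vec.
have [w wE] := choice coef_exists.
exists K, (fun k q => w q k), (fun i k => sval (s k) i); split=> [i|j k].
  by apply/funext => q; rewrite wE fct_sumE.
exact: (svalP (s k)).
Qed.

Lemma self_injective_flat_embedding (M : lmodType R) :
  exists (F : lmodType R) (h : {linear M -> F}), flat F /\ injective h.
Proof.
have R_semi := self_injective_semiartinian R_inj R_noeth.
have R_art := noetherian_artinian R_semi R_noeth.
have [X [h h_inj]] := function_module_embedding R_art R_semi R_inj M.
exists (X -> R^o : lmodType R), h; split=> //.
exact/eq_flat_flat/self_injective_eq_flat_function_module.
Qed.

End QuasiFrobenius.

(** * The flat-precover completing domains *)

Lemma free_flat_precover (R : pzRingType) (N : lmodType R) :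
    (forall V : lmodType R, eq_flat V -> injective_module V) ->
  flat_precover (free_lift (@id N)).
Proof.
move=> flat_inj; split=> [|F' F'_flat u]; first exact/eq_flat_flat/eq_flat_free.
have [s sE] := eq_flat_surjection_splits flat_inj (@free_lift_id_surj R F')
  (@eq_flat_free R F') (flat_eq_flat F'_flat).
exists (free_lift (fun x => free_gen R (u x)) \o s) => x.
rewrite -[RHS]/(u x) -[in RHS](sE x) linear_free_lift.
rewrite -[LHS]/(free_lift id (free_lift _ (s x))) linear_free_lift.
by congr (free_lift _ (s x) : N); apply/funext => z; apply: free_lift_gen.
Qed.

Lemma injective_separating_family (R : pzRingType) (V : lmodType R) (X : choiceType)
    (P : X -> V -> Prop) : (forall x, is_submodule (P x)) ->
  exists2 E : lmodType R, injective_module E &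
    exists phi : X -> {linear V -> E}, forall x v, phi x v = 0 <-> P x v.
Proof.
move=> P_sub.
have Q_sub : is_submodule (fun f : finsupp X V => forall x, P x (fseval f x)).
  apply: bigcap_submodule => x; have [P0 PD PZ] := P_sub x.
  by split=> [//|f g|r f]; [apply: PD | apply: PZ].
have [E [i [E_inj i_inj]]] := injective_embedding (quotmod Q_sub).
exists E => //; exists (fun x => i \o (quotmod_pi Q_sub \o fsingle x)) => x v.
rewrite -[0](linear0 i); split=> [/i_inj/quotmod_pi_eq0/(_ x)|Pxv].
  by rewrite fsingleE eqxx.
congr (i _); apply/quotmod_pi_eq0 => y; rewrite fsingleE; case: eqP => [->//|_].
exact: (submodule0 (P_sub y)).
Qed.

(* Bass-Papp: extend [r |-> (r mod I n)_n] from the union of the chain to [R]. *)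
Lemma noetherian_of_injective_sums (R : pzRingType) :
    (forall E : lmodType R, injective_module E -> injective_module (finsupp nat E)) ->
  noetherian_module (R^o : lmodType R).
Proof.
move=> sums_inj I I_sub I_asc.
have [E E_inj [phi phiP]] := injective_separating_family I_sub.
have U_sub : is_submodule (fun r => exists n, I n r).
  apply: (directed_submodule 0%N) => // m n; exists (maxn m n).
  by split=> r; apply: ascending_mono => //; [apply: leq_maxl | apply: leq_maxr].
have f_lin : linear (fun (r : submod U_sub) n => phi n (submod_val r)).
  by move=> t r s; apply/funext => n; apply: linearP.
have f_fin r : finsupp_fun (linear_fun f_lin r).
  have [m Im] := submodP r; exists (iota 0 m) => n; rewrite mem_iota -leqNgt => mn.
  exact/phiP/(ascending_mono I_asc mn).
have [w wE] := injective_baer (sums_inj E E_inj)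
  (submod_corestr (finsupp_submodule nat E) f_fin).
have [s _ /(_ tt) ws] := covers_exists (fun _ : unit => w).
pose n := (\max_(k <- s) k).+1.
have ns : n \notin s.
  by apply/negP => /(@leq_bigmax_seq _ s predT id n)/(_ isT); rewrite ltnn.
exists n => m r _ Ir; apply/phiP.
have := congr1 (@fseval _ _ _ ^~ n) (wE (submod_in U_sub (ex_intro _ m Ir))).
by rewrite fsevalZ ws // scaler0.
Qed.

Section EqualDomains.
Variable R : pzRingType.
Hypothesis domains : forall M N : lmodType R,
  flat_precover_completing_domain M N <-> subinjectivity_domain N M.

Lemma domains_flat_injective (F : lmodType R) : eq_flat F -> injective_module F.
Proof.
move=> /eq_flat_flat F_flat.
have F_sub : subinjectivity_domain F F by apply/domains => f G g [_]; apply.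
have [E [e [E_inj e_inj]]] := injective_embedding F.
have [p pe] := F_sub _ _ e_inj idfun.
move=> A B i i_inj f; have [g gE] := E_inj _ _ _ i_inj (e \o f).
by exists (p \o g) => a /=; rewrite [g (i a)]gE; apply: pe.
Qed.

Lemma domains_injective_flat (E : lmodType R) : injective_module E -> eq_flat E.
Proof.
move=> E_inj.
have /domains E_dom : subinjectivity_domain E E by move=> K i i_inj f; apply: E_inj.
have [h hE] := E_dom idfun _ _ (free_flat_precover E domains_flat_injective).
exact: (eq_flat_retract hE (@eq_flat_free R E)).
Qed.

Lemma domains_quasi_Frobenius : quasi_Frobenius R.
Proof.
split; last exact/domains_flat_injective/eq_flat_regular.
apply: noetherian_of_injective_sums => E E_inj.
exact/domains_flat_injective/eq_flat_finsupp/domains_injective_flat.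
Qed.

End EqualDomains.

Theorem proposition4p2 (R : pzRingType) :
  quasi_Frobenius R <->
  (forall M N : lmodType R,
     flat_precover_completing_domain M N <-> subinjectivity_domain N M).
Proof.
split=> [[R_noeth R_inj] M N|]; last exact: domains_quasi_Frobenius.
have flat_inj := self_injective_eq_flat_injective R_noeth R_inj.
split=> [dom K i i_inj f|sub f F g [_ g_cover]].
  have [h hE] := dom f _ _ (free_flat_precover N flat_inj).
  have [k kE] := flat_inj _ (@eq_flat_free R N) _ _ _ i_inj h.
  exists (free_lift id \o k) => x; rewrite -[RHS]hE.
  by congr (free_lift id _ : N); apply: kE.
have [E [e [E_flat e_inj]]] := self_injective_flat_embedding R_noeth R_inj M.
have [f' f'E] := sub _ _ e_inj f; have [v vE] := g_cover _ E_flat f'.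
by exists (v \o e) => x; rewrite -[RHS]f'E; apply: vE.
Qed.
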